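(* 1. There exists a unique homogeneous Hopf algebra morphism $\phi_0$ from $(\mathcal{H}_{\mathbf{qp}},m,\Delta)$ to $(\mathbb{K}[X],m,\Delta)$ such that $\phi_0(\bullet_n)=X$ for all $n\geq1$. There exists a unique character $\lambda\in M_{\mathbf{qp}}$ such that for all $P\in\mathbf{qp}$, $$\phi_0(P)=\lambda_PX^{cl(P)}.$$ 2. There exist unique characters $\alpha,\alpha^{str}\in M_{\mathbf{qp}}$ such that $$ehr=\phi_0\leftarrow\alpha,\qquad ehr^{str}=\phi_0\leftarrow\alpha^{str}.$$
   Context: $\mathbb{K}$ is a field of characteristic zero. A quasi-poset is a pair $P=(A,\leq_P)$ with $A$ finite and $\leq_P$ reflexive and transitive; $x\sim_Py$ means $x\leq_Py$ and $y\leq_Px$; $cl(P)$ is the number of $\sim_P$-classes; $\lfloor P\rfloor$ is the isoclass; $P_{\mid B}$ is the restriction to $B\subseteq A$; $top(P)$ is the topology of open sets, i.e. subsets $O$ with ($i\in O$, $i\leq_Pj$)$\Rightarrow j\in O$; $P$ is connected if this topology is connected. For an equivalence $\sim$ on $A$: $x\leq_{P|\sim}y$ iff $x\leq_Py$ and $x\sim y$; $\leq_{P/\sim}$ is the transitive closure of the relation ($x\leq_Py$ or $x\sim y$); these give quasi-posets $P|\sim$ and $P/\sim$ on $A$. We write $\sim\triangleleft P$ if the restriction of $P$ to each class of $\sim$ is connected and $\sim_{P/\sim}$ equals $\sim$. $\bullet_n\in\mathbf{qp}$ is the isoclass of the quasi-poset with $n$ pairwise equivalent elements. $\mathcal{H}_{\mathbf{qp}}$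 is the $\mathbb{K}$-vector space with basis the set $\mathbf{qp}$ of isoclasses of quasi-posets, with product $m$ given by disjoint union (unit: empty quasi-poset), and coproducts $\Delta(\lfloor P\rfloor)=\sum_{O\in top(P)}\lfloor P_{\mid A\setminus O}\rfloor\otimes\lfloor P_{\mid O}\rfloor$ and $\delta(\lfloor P\rfloor)=\sum_{\sim\triangleleft P}\lfloor P/\sim\rfloor\otimes\lfloor P|\sim\rfloor$. $(\mathcal{H}_{\mathbf{qp}},m,\Delta)$ is a Hopf algebra, graded by $(\mathcal{H}_{\mathbf{qp}})_n=Vect(P\in\mathbf{qp}\mid cl(P)=n)$; $(\mathcal{H}_{\mathbf{qp}},m,\delta)$ is a bialgebra. $\mathbb{K}[X]$ has its usual product, the grading by degree and the coproduct $\Delta(X)=X\otimes1+1\otimes X$; homogeneous means degree-preserving. $M_{\mathbf{qp}}$ is the set of characters (algebra morphisms to $\mathbb{K}$) of $(\mathcal{H}_{\mathbf{qp}},m)$; $\lambda_P=\lambda(P)$. For a Hopf algebra morphism $\phi:(\mathcal{H}_{\mathbf{qp}},m,\Delta)\to(\mathbb{K}[X],m,\Delta)$ and $\lambda\in M_{\mathbf{qp}}$, $\phi\leftarrow\lambda=(\phi\otimes\lambda)\circ\delta$. For $k\ge1$, $L_P(k)$ is the set of maps $f:A\to\{1,\ldots,k\}$ with $i\leq_Pj\Rightarrow f(i)\leq f(j)$, and $L^{str}_P(k)$ the set of $f\in L_P(k)$ such that ($i\leq_Pj$ and $f(i)=f(j)$)$\Rightarrow i\sim_Pj$. $ehr_P$,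 $ehr_P^{str}$ are the unique polynomials with $ehr_P(k)=\sharp L_P(k)$, $ehr_P^{str}(k)=\sharp L_P^{str}(k)$ for all $k\geq1$; $ehr,ehr^{str}:\mathcal{H}_{\mathbf{qp}}\to\mathbb{K}[X]$ are the corresponding linear maps (Hopf algebra morphisms for $\Delta$). *)

(* Defs.v *)
From HB Require Import structures.
From mathcomp Require Import all_boot all_order all_algebra.
From mathcomp Require Import finmap.
From mathcomp.multinomials Require Import monalg.

Set Implicit Arguments.
Unset Strict Implicit.
Unset Printing Implicit Defensive.

Import GRing.Theory.
Local Open Scope ring_scope.
Local Open Scope quotient_scope.

Section QPoset.
Variable A : finType.

Definition is_preorder (r : {ffun A * A -> bool}) : bool :=
  [forall x, r (x, x)] &&
  [forall x, forall y, forall z, r (x, y) ==> r (y, z) ==> r (x, z)].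

Record qposet : predArgType :=
  QPoset { qp_graph : {ffun A * A -> bool}; _ : is_preorder qp_graph }.

HB.instance Definition _ := [isSub for qp_graph].
HB.instance Definition _ := [Finite of qposet by <:].

Definition le_qp (P : qposet) : rel A := fun x y => qp_graph P (x, y).

Lemma is_preorderP (r : {ffun A * A -> bool}) :
  reflect (reflexive (fun x y => r (x, y)) /\ transitive (fun x y => r (x, y)))
          (is_preorder r).
Proof.
apply: (iffP andP) => -[rr tr]; split.
- by move=> x; have /forallP := rr; apply.
- move=> y x z rxy ryz.
  by have /forallP/(_ x)/forallP/(_ y)/forallP/(_ z) := tr; rewrite rxy ryz.
- by apply/forallP.
- apply/forallP=> x; apply/forallP=> y; apply/forallP=> z.
  by apply/implyP=> rxy; apply/implyP; apply: tr rxy.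
Qed.

Lemma le_qp_refl (P : qposet) : reflexive (le_qp P).
Proof. by case: P => r rP; have /is_preorderP[] := rP. Qed.

Lemma le_qp_trans (P : qposet) : transitive (le_qp P).
Proof. by case: P => r rP; have /is_preorderP[] := rP. Qed.

Lemma mk_qposet_subproof (r : rel A) (rr : reflexive r) (tr : transitive r) :
  is_preorder [ffun u => r u.1 u.2].
Proof.
by apply/is_preorderP; split=> [x|y x z]; rewrite !ffunE //=; apply: tr.
Qed.

Definition mk_qposet (r : rel A) (rr : reflexive r) (tr : transitive r) :
  qposet := QPoset (mk_qposet_subproof rr tr).

Lemma mk_qposetE r rr tr : le_qp (@mk_qposet r rr tr) =2 r.
Proof. by move=> x y; rewrite /le_qp ffunE. Qed.

Definition sim_qp (P : qposet) : rel A := fun x y => le_qp P x y && le_qp P y x.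

(* cl(P) *)
Definition cl_on (P : qposet) : nat :=
  #|equivalence_partition (sim_qp P) [set: A]|.

(* O \in top(P) *)
Definition open_qp (P : qposet) (O : {set A}) : bool :=
  [forall i, forall j, (i \in O) ==> le_qp P i j ==> (j \in O)].

(* The only open and closed subsets for top(P) are set0 and setT. *)
Definition connected_qp (P : qposet) : bool :=
  [forall O : {set A},
     open_qp P O && open_qp P (~: O) ==> (O == set0) || (O == setT)].

Definition sym_qp (P : qposet) : bool :=
  [forall x, forall y, le_qp P x y ==> le_qp P y x].

(* An equivalence on A is a symmetric quasi-poset on A. *)
Record equivalence : predArgType :=
  Equivalence { qp_of_equiv :> qposet; _ : sym_qp qp_of_equiv }.

HB.instance Definition _ := [isSub for qp_of_equiv].
HB.instance Definition _ := [Finite of equivalence by <:].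

(* P | ~ *)
Lemma restr_equiv_refl (P : qposet) (E : equivalence) :
  reflexive (fun x y => le_qp P x y && le_qp E x y).
Proof. by move=> x; rewrite !le_qp_refl. Qed.

Lemma restr_equiv_trans (P : qposet) (E : equivalence) :
  transitive (fun x y => le_qp P x y && le_qp E x y).
Proof.
move=> y x z /andP[Pxy Exy] /andP[Pyz Eyz].
by rewrite (le_qp_trans Pxy Pyz) (le_qp_trans Exy Eyz).
Qed.

Definition restr_equiv (P : qposet) (E : equivalence) : qposet :=
  mk_qposet (restr_equiv_refl P E) (@restr_equiv_trans P E).

(* P / ~ ; connect is the reflexive transitive closure, and the relation is   *)
(* already reflexive.                                                         *)
Definition contract_equiv (P : qposet) (E : equivalence) : qposet :=
  mk_qposet (connect0 (fun x y => le_qp P x y || le_qp E x y))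
            (@connect_trans _ (fun x y => le_qp P x y || le_qp E x y)).

End QPoset.

Section Pullback.
Variables (A B : finType) (f : B -> A) (P : qposet A).

Lemma pull_refl : reflexive (fun x y => le_qp P (f x) (f y)).
Proof. by move=> x; apply: le_qp_refl. Qed.

Lemma pull_trans : transitive (fun x y => le_qp P (f x) (f y)).
Proof. by move=> y x z; apply: le_qp_trans. Qed.

Definition pull_qp : qposet B := mk_qposet pull_refl pull_trans.

End Pullback.

(* P_{| B}, on the subtype of elements of B *)
Definition restr_qp (A : finType) (P : qposet A) (B : {set A}) :
  qposet {x : A | x \in B} := pull_qp val P.

(* ~ <| P *)
Definition admissible (A : finType) (P : qposet A) (E : equivalence A) : bool :=
  [forall x, connected_qp (restr_qp P [set y | le_qp E x y])] &&
  [forall x, forall y, sim_qp (contract_equiv P E) x y == le_qp E x y].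

Section DisjointUnion.
Variables (A B : finType) (P : qposet A) (Q : qposet B).

Definition sum_rel : rel (A + B) := fun u v =>
  match u, v with
  | inl x, inl y => le_qp P x y
  | inr x, inr y => le_qp Q x y
  | _, _ => false
  end.

Lemma sum_rel_refl : reflexive sum_rel.
Proof. by case=> x /=; apply: le_qp_refl. Qed.

Lemma sum_rel_trans : transitive sum_rel.
Proof. by case=> y [] x [] z //=; apply: le_qp_trans. Qed.

Definition sum_qp : qposet (A + B)%type := mk_qposet sum_rel_refl sum_rel_trans.

End DisjointUnion.

Lemma true_trans (A : finType) : transitive (fun _ _ : A => true).
Proof. by []. Qed.

Definition total_qp (A : finType) : qposet A :=
  mk_qposet (fun _ => isT) (@true_trans A).

Definition iso_qp (A B : finType) (P : qposet A) (Q : qposet B) : bool :=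
  [exists f : {ffun A -> B}, [&& injectiveb f, #|A| == #|B| &
     [forall x, forall y, le_qp Q (f x) (f y) == le_qp P x y]]].

Lemma iso_qpP (A B : finType) (P : qposet A) (Q : qposet B) :
  reflect (exists2 f : A -> B, bijective f &
             forall x y, le_qp Q (f x) (f y) = le_qp P x y)
          (iso_qp P Q).
Proof.
apply: (iffP existsP) => [[f /and3P[/injectiveP fI /eqP cAB /forallP fP]]|].
  exists f; first by apply: inj_card_bij; rewrite ?cAB.
  by move=> x y; have /forallP/(_ y)/eqP := fP x.
case=> f fB fP; exists (finfun f); apply/and3P; split.
- by apply/injectiveP=> x y; rewrite !ffunE; apply: bij_inj.
- by rewrite (bij_eq_card fB).
- by apply/forallP=> x; apply/forallP=> y; rewrite !ffunE fP.
Qed.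

Lemma iso_qp_refl (A : finType) (P : qposet A) : iso_qp P P.
Proof. by apply/iso_qpP; exists id => //; exists id. Qed.

Lemma iso_qp_sym (A B : finType) (P : qposet A) (Q : qposet B) : iso_qp P Q -> iso_qp Q P.
Proof.
case/iso_qpP=> f [g fK gK] fP; apply/iso_qpP; exists g; first by exists f.
by move=> x y; rewrite -fP !gK.
Qed.

Lemma iso_qp_trans (A B C : finType) (P : qposet A) (Q : qposet B) (S : qposet C) :
  iso_qp P Q -> iso_qp Q S -> iso_qp P S.
Proof.
case/iso_qpP=> f fB fP /iso_qpP[g gB gP]; apply/iso_qpP.
by exists (g \o f) => [|x y /=]; [exact: bij_comp | rewrite gP fP].
Qed.

Definition ord_qposet : Type := {n : nat & qposet 'I_n}.
HB.instance Definition _ := Choice.on ord_qposet.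

Definition iso_ord : rel ord_qposet := fun u v => iso_qp (tagged u) (tagged v).

Lemma iso_ord_refl : reflexive iso_ord.
Proof. by move=> u; apply: iso_qp_refl. Qed.

Lemma iso_ord_sym : symmetric iso_ord.
Proof. by move=> u v; apply/idP/idP; apply: iso_qp_sym. Qed.

Lemma iso_ord_trans : transitive iso_ord.
Proof. by move=> v u w; apply: iso_qp_trans. Qed.

Canonical iso_ord_equiv := EquivRel iso_ord iso_ord_refl iso_ord_sym iso_ord_trans.

Definition qp : Type := {eq_quot iso_ord}.
HB.instance Definition _ := Choice.on qp.

Definition isoclass (A : finType) (P : qposet A) : qp :=
  \pi_{eq_quot iso_ord} (Tagged (fun n => qposet 'I_n) (pull_qp (@enum_val A A) P)).

Definition repr_qp (p : qp) : qposet 'I_(tag (repr p)) := tagged (repr p).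

Lemma pull_iso (A B : finType) (f : B -> A) (P : qposet A) :
  bijective f -> iso_qp (pull_qp f P) P.
Proof. by move=> fB; apply/iso_qpP; exists f => // x y; rewrite mk_qposetE. Qed.

Lemma isoclassP (A B : finType) (P : qposet A) (Q : qposet B) :
  reflect (isoclass P = isoclass Q) (iso_qp P Q).
Proof.
have E C (S : qposet C) : iso_qp (pull_qp (@enum_val C C) S) S.
  exact/pull_iso/enum_val_bij.
apply: (iffP idP) => [PQ|/eqmodP/= PQ].
  apply/eqmodP => /=.
  exact: iso_qp_trans (iso_qp_trans (E _ P) PQ) (iso_qp_sym (E _ Q)).
exact: iso_qp_trans (iso_qp_trans (iso_qp_sym (E _ P)) PQ) (E _ Q).
Qed.

Lemma repr_qpK (p : qp) : isoclass (repr_qp p) = p.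
Proof.
rewrite -[RHS]reprK; apply/eqmodP => /=.
exact/pull_iso/enum_val_bij.
Qed.

Lemma iso_repr_qp (A : finType) (P : qposet A) : iso_qp (repr_qp (isoclass P)) P.
Proof. by apply/isoclassP; rewrite repr_qpK. Qed.

Definition empty_qp : qp := isoclass (total_qp 'I_0).

Definition union_qp (p q : qp) : qp := isoclass (sum_qp (repr_qp p) (repr_qp q)).

Lemma sum_iso (A A' B B' : finType) (P : qposet A) (P' : qposet A') (Q : qposet B)
    (Q' : qposet B') :
  iso_qp P P' -> iso_qp Q Q' -> iso_qp (sum_qp P Q) (sum_qp P' Q').
Proof.
case/iso_qpP=> f [f' fK f'K] fP /iso_qpP[g [g' gK g'K] gP]; apply/iso_qpP.
exists (fun u => match u with inl x => inl (f x) | inr y => inr (g y) end).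
  exists (fun u => match u with inl x => inl (f' x) | inr y => inr (g' y) end).
    by case=> x; rewrite ?fK ?gK.
  by case=> x; rewrite ?f'K ?g'K.
by move=> [x|x] [y|y]; rewrite !mk_qposetE /= ?fP ?gP.
Qed.

Lemma union_isoclass (A B : finType) (P : qposet A) (Q : qposet B) :
  union_qp (isoclass P) (isoclass Q) = isoclass (sum_qp P Q).
Proof. by apply/isoclassP; apply: sum_iso; apply: iso_repr_qp. Qed.

Lemma union_qpA : associative union_qp.
Proof.
move=> p q r; rewrite -[p]repr_qpK -[q]repr_qpK -[r]repr_qpK !union_isoclass.
apply/isoclassP/iso_qpP.
exists (fun u => match u with
  | inl x => inl (inl x) | inr (inl y) => inl (inr y) | inr (inr z) => inr z end).
  exists (fun u => match u with
    | inl (inl x) => inl x | inl (inr y) => inr (inl y) | inr z => inr (inr z) end).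
    by case=> [|[]].
  by case=> [[]|].
by case=> [x|[x|x]] [y|[y|y]]; rewrite !mk_qposetE //= !mk_qposetE.
Qed.

Lemma union_qpC : commutative union_qp.
Proof.
move=> p q; rewrite -[p]repr_qpK -[q]repr_qpK !union_isoclass.
apply/isoclassP/iso_qpP.
exists (fun u => match u with inl x => inr x | inr x => inl x end).
  by exists (fun u => match u with inl x => inr x | inr x => inl x end); case.
by move=> [x|x] [y|y]; rewrite !mk_qposetE.
Qed.

Lemma union_qp0 : left_id empty_qp union_qp.
Proof.
move=> p; rewrite -[p]repr_qpK union_isoclass.
apply/isoclassP/iso_qp_sym/iso_qpP; exists inr; last first.
  by move=> x y; rewrite mk_qposetE.
apply: inj_card_bij; first by move=> x y [].
by rewrite card_sum card_ord.
Qed.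

Lemma union_0qp : right_id empty_qp union_qp.
Proof. by move=> p; rewrite union_qpC union_qp0. Qed.

Lemma union_qp_eq0 p q :
  union_qp p q = empty_qp -> p = empty_qp /\ q = empty_qp.
Proof.
rewrite -[p]repr_qpK -[q]repr_qpK union_isoclass => /isoclassP/iso_qpP[f _ _].
split; apply/isoclassP/iso_qpP.
  exists (f \o inl); last by move=> x; case: (f (inl x)).
  by exists (fun i : 'I_0 => match notF (ltn_ord i) with end) => [x|[]] //;
    case: (f (inl x)).
exists (f \o inr); last by move=> x; case: (f (inr x)).
by exists (fun i : 'I_0 => match notF (ltn_ord i) with end) => [x|[]] //;
  case: (f (inr x)).
Qed.

HB.instance Definition _ := Choice_isMonomialDef.Build qp
  union_qpA union_qp0 union_0qp union_qp_eq0.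
HB.instance Definition _ := MonomialDef_isConomialDef.Build qp union_qpC.

Definition cl (p : qp) : nat := cl_on (repr_qp p).

Definition bullet (n : nat) : qp := isoclass (total_qp 'I_n).

(* 'I_k stands for {1, ..., k}. *)
Section OrderMaps.
Variables (A : finType) (P : qposet A) (k : nat).

Definition L_maps : {set {ffun A -> 'I_k}} :=
  [set f : {ffun A -> 'I_k} | [forall i, forall j, le_qp P i j ==> (f i <= f j)%N]].

Definition Lstr_maps : {set {ffun A -> 'I_k}} :=
  [set f in L_maps |
     [forall i, forall j, le_qp P i j && (f i == f j) ==> sim_qp P i j]].

End OrderMaps.

Lemma connect_homo (A B : finType) (e : rel A) (e' : rel B) (f : A -> B) :
  {homo f : x y / e x y >-> e' x y} ->
  {homo f : x y / connect e x y >-> connect e' x y}.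
Proof.
move=> fe x _ /connectP[s + ->]; elim: s x => [|z s IH] x /=.
  by rewrite connect0.
by case/andP=> xz /IH; apply: connect_trans; apply/connect1/fe.
Qed.

Section Invariance.
Variables (A B : finType) (P : qposet A) (Q : qposet B).
Variables (f : A -> B) (g : B -> A) (fK : cancel f g) (gK : cancel g f).
Hypothesis fP : forall x y, le_qp Q (f x) (f y) = le_qp P x y.

Let gP x y : le_qp P (g x) (g y) = le_qp Q x y.
Proof. by rewrite -fP !gK. Qed.

Let preim_bij : bijective (fun O : {set B} => f @^-1: O).
Proof.
by exists (fun O : {set A} => g @^-1: O) => O; apply/setP=> x;
  rewrite !inE ?gK ?fK.
Qed.

Let sim_inv x y : sim_qp Q (f x) (f y) = sim_qp P x y.
Proof. by rewrite /sim_qp !fP. Qed.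

Lemma cl_on_inv : cl_on P = cl_on Q.
Proof.
rewrite /cl_on -(card_imset _ (bij_inj preim_bij)); congr #|pred_of_set _|.
apply/setP=> S; apply/imsetP/imsetP => [[x _ ->]|[_ /imsetP[y _ ->] ->]].
  exists [set y in [set: B] | sim_qp Q (f x) y]; first exact: imset_f.
  by apply/setP=> z; rewrite !inE sim_inv.
by exists (g y); rewrite //; apply/setP=> z; rewrite !inE -sim_inv gK.
Qed.

Lemma open_inv (O : {set B}) : open_qp P (f @^-1: O) = open_qp Q O.
Proof.
apply/forallP/forallP=> h i; apply/forallP=> j; apply/implyP=> iO;
  apply/implyP=> ij.
- have /forallP/(_ (g j)) := h (g i).
  by rewrite !inE !gK gP iO ij.
- have /forallP/(_ (f j)) := h (f i).
  by rewrite fP ij inE; move: iO; rewrite inE => ->.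
Qed.

Lemma connected_inv : connected_qp P = connected_qp Q.
Proof.
have E0 (O : {set B}) : (f @^-1: O == set0) = (O == set0).
  by rewrite -(inj_eq (bij_inj preim_bij) O) preimset0.
have ET (O : {set B}) : (f @^-1: O == setT) = (O == setT).
  by rewrite -(inj_eq (bij_inj preim_bij) O) preimsetT.
apply/forallP/forallP=> h O.
  by have := h (f @^-1: O); rewrite -preimsetC !open_inv E0 ET.
have [g' _ g'K] := preim_bij.
by rewrite -[O]g'K -preimsetC !open_inv E0 ET.
Qed.

End Invariance.

Lemma connected_iso (A B : finType) (P : qposet A) (Q : qposet B) :
  iso_qp P Q -> connected_qp P = connected_qp Q.
Proof. by case/iso_qpP=> f [g fK gK] fP; apply: connected_inv fK gK fP. Qed.

Section Invariance2.
Variables (A B : finType) (P : qposet A) (Q : qposet B).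
Variables (f : A -> B) (g : B -> A) (fK : cancel f g) (gK : cancel g f).
Hypothesis fP : forall x y, le_qp Q (f x) (f y) = le_qp P x y.

Let gP x y : le_qp P (g x) (g y) = le_qp Q x y.
Proof. by rewrite -fP !gK. Qed.

Let preim_bij : bijective (fun O : {set B} => f @^-1: O).
Proof.
by exists (fun O : {set A} => g @^-1: O) => O; apply/setP=> x;
  rewrite !inE ?gK ?fK.
Qed.

Let sim_inv x y : sim_qp Q (f x) (f y) = sim_qp P x y.
Proof. by rewrite /sim_qp !fP. Qed.

Lemma restr_inv (O : {set B}) : iso_qp (restr_qp P (f @^-1: O)) (restr_qp Q O).
Proof.
have f1 (u : {x | x \in f @^-1: O}) : f (val u) \in O.
  by have := valP u; rewrite inE.
have g1 (u : {x | x \in O}) : g (val u) \in f @^-1: O by rewrite inE gK; apply: valP.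
apply/iso_qpP; exists (fun u => Sub (f (val u)) (f1 u)).
  by exists (fun u => Sub (g (val u)) (g1 u)) => u; apply/val_inj;
    rewrite !SubK ?fK ?gK.
by move=> u v; rewrite !mk_qposetE !SubK fP.
Qed.

Lemma sum_open_inv (V : nmodType) (F : qp -> qp -> V) :
  \sum_(O : {set A} | open_qp P O)
     F (isoclass (restr_qp P (~: O))) (isoclass (restr_qp P O)) =
  \sum_(O : {set B} | open_qp Q O)
     F (isoclass (restr_qp Q (~: O))) (isoclass (restr_qp Q O)).
Proof.
rewrite (reindex _ (onW_bij _ preim_bij)) /=; apply: eq_big => O.
  exact: open_inv.
by rewrite -preimsetC => _; congr F; apply/isoclassP/restr_inv.
Qed.

Let pull_sym (C D : finType) (h : C -> D) (E : equivalence D) :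
  sym_qp (pull_qp h E).
Proof.
apply/forallP=> x; apply/forallP=> y; rewrite !mk_qposetE.
by have /forallP/(_ (h x))/forallP := valP E; apply.
Qed.

Let pull_eqv (C D : finType) (h : C -> D) (E : equivalence D) :=
  Equivalence (pull_sym h E).

Let eqv_ext (C : finType) (E E' : equivalence C) :
  le_qp E =2 le_qp E' -> E = E'.
Proof.
by move=> h; do 2!apply/val_inj; apply/ffunP=> -[x y]; apply: h.
Qed.

Let pull_eqv_bij : bijective (pull_eqv f).
Proof.
by exists (pull_eqv g) => E; apply: eqv_ext => x y; rewrite !mk_qposetE ?gK ?fK.
Qed.

Let contract_inv E x y :
  le_qp (contract_equiv P (pull_eqv f E)) x y =
  le_qp (contract_equiv Q E) (f x) (f y).
Proof.
rewrite !mk_qposetE; apply/idP/idP => [|xy].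
  by apply: connect_homo => {}x {}y; rewrite fP mk_qposetE.
rewrite -[x]fK -[y]fK; apply: connect_homo xy => {}x {}y.
by rewrite gP mk_qposetE !gK.
Qed.

Lemma admissible_inv E : admissible P (pull_eqv f E) = admissible Q E.
Proof.
have cE x : connected_qp (restr_qp P [set y | le_qp (pull_eqv f E) x y]) =
            connected_qp (restr_qp Q [set y | le_qp E (f x) y]).
  have <- : f @^-1: [set y | le_qp E (f x) y] =
            [set y | le_qp (pull_eqv f E) x y].
    by apply/setP=> y; rewrite !inE mk_qposetE.
  exact/connected_iso/restr_inv.
have sE x y : sim_qp (contract_equiv P (pull_eqv f E)) x y =
              sim_qp (contract_equiv Q E) (f x) (f y).
  by rewrite /sim_qp !contract_inv.
rewrite /admissible; congr andb.
  apply/forallP/forallP=> h x; last by rewrite cE.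
  by have := h (g x); rewrite cE gK.
apply/forallP/forallP=> h x; apply/forallP=> y.
  by have /forallP/(_ (g y)) := h (g x); rewrite sE mk_qposetE !gK.
by have /forallP/(_ (f y)) := h (f x); rewrite sE mk_qposetE.
Qed.

Lemma sum_admissible_inv (V : nmodType) (F : qp -> qp -> V) :
  \sum_(E : equivalence A | admissible P E)
     F (isoclass (contract_equiv P E)) (isoclass (restr_equiv P E)) =
  \sum_(E : equivalence B | admissible Q E)
     F (isoclass (contract_equiv Q E)) (isoclass (restr_equiv Q E)).
Proof.
rewrite (reindex _ (onW_bij _ pull_eqv_bij)) /=; apply: eq_big => E.
  exact: admissible_inv.
move=> _; congr F; apply/isoclassP/iso_qpP; exists f; try by exists g.
  by move=> x y; rewrite contract_inv.
by move=> x y; rewrite !mk_qposetE fP.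
Qed.

Let ffun_bij k : bijective (fun h : {ffun B -> 'I_k} => [ffun x => h (f x)]).
Proof.
by exists (fun h : {ffun A -> 'I_k} => [ffun x => h (g x)]) => h;
  apply/ffunP=> x; rewrite !ffunE ?gK ?fK.
Qed.

Let L_inv k (h : {ffun B -> 'I_k}) :
  ([ffun x => h (f x)] \in L_maps P k) = (h \in L_maps Q k).
Proof.
rewrite !inE; apply/forallP/forallP=> H x; apply/forallP=> y.
  by have /forallP/(_ (g y)) := H (g x); rewrite !ffunE !gK gP.
by have /forallP/(_ (f y)) := H (f x); rewrite !ffunE fP.
Qed.

Lemma card_L_inv k : #|L_maps P k| = #|L_maps Q k|.
Proof.
rewrite -!sum1_card (reindex _ (onW_bij _ (ffun_bij k))) /=.
by apply: eq_bigl => h; apply: L_inv.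
Qed.

Lemma card_Lstr_inv k : #|Lstr_maps P k| = #|Lstr_maps Q k|.
Proof.
rewrite -!sum1_card (reindex _ (onW_bij _ (ffun_bij k))) /=.
apply: eq_bigl => h; rewrite inE [in RHS]inE L_inv; congr andb.
apply/forallP/forallP=> H x; apply/forallP=> y.
  by have /forallP/(_ (g y)) := H (g x); rewrite !ffunE !gK gP -sim_inv !gK.
by have /forallP/(_ (f y)) := H (f x); rewrite !ffunE fP sim_inv.
Qed.

End Invariance2.

Section Counting.
Variables (A : finType) (Phi : pred {ffun A * A -> bool}).

(* The total preorder on A induced by a map to 'I_k *)
Let ord_of k (f : {ffun A -> 'I_k}) := [ffun u : A * A => (f u.1 <= f u.2)%N].

Let onto k (T : {set 'I_k}) :=
  [set f : {ffun A -> 'I_k} | Phi (ord_of f) & f @: setT == T].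

Let c j := #|onto [set: 'I_j]|.

Let c_gt j : (#|A| < j)%N -> c j = 0%N.
Proof.
move=> lt; apply/eqP; rewrite cards_eq0 -subset0; apply/subsetP=> f.
rewrite !inE => /andP[_ /eqP fT]; have := leq_imset_card f setT.
by rewrite fT !cardsT card_ord leqNgt lt.
Qed.

Let card_onto k (T : {set 'I_k}) : #|onto T| = c #|T|.
Proof.
have e_le (i j : 'I_#|T|) : (enum_val i <= enum_val j)%N = (i <= j)%N.
  have sT : sorted ltn (map val (enum T)).
    apply: (subseq_sorted ltn_trans (s2 := map val (enum 'I_k))).
      by apply: map_subseq; rewrite {1}/enum_mem -enumT; apply: filter_subseq.
    by rewrite val_enum_ord iota_ltn_sorted.
  have h (u v : 'I_#|T|) : (u < v)%N -> (enum_val u < enum_val v)%N.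
    move=> uv; have x0 : 'I_k := enum_val u; rewrite !(enum_val_nth x0).
    rewrite -!(nth_map _ 0%N val) -?cardE //.
    by apply: (sorted_ltn_nth ltn_trans); rewrite ?inE ?size_map -?cardE.
  case: (ltngtP i j) => [ij|ij|/val_inj ->]; last by rewrite leqnn.
    by rewrite ltnW ?h.
  by apply/negbTE; rewrite -ltnNge h.
pose F (g : {ffun A -> 'I_#|T|}) : {ffun A -> 'I_k} := [ffun x => enum_val (g x)].
have FI : injective F.
  move=> g g' /ffunP E; apply/ffunP=> x; apply: (@enum_val_inj _ T).
  by have := E x; rewrite !ffunE.
have Ford g : ord_of (F g) = ord_of g.
  by apply/ffunP=> u; rewrite !ffunE e_le.
rewrite /c -(card_imset _ FI); congr #|pred_of_set _|; apply/setP=> f.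
apply/idP/imsetP => [|[g]].
  rewrite inE => /andP[fP /eqP fT].
  have fx x : f x \in T by rewrite -fT imset_f.
  pose g := [ffun x => enum_rank_in (fx x) (f x)].
  have fE : f = F g by apply/ffunP=> x; rewrite !ffunE enum_rankK_in.
  exists g => //; rewrite inE -Ford -fE fP /=; apply/eqP/setP=> i; rewrite inE.
  have : enum_val i \in f @: setT by rewrite fT enum_valP.
  case/imsetP=> x _; rewrite fE ffunE => /enum_val_inj ->; exact: imset_f.
rewrite !inE => /andP[gP /eqP gT] ->; rewrite Ford gP /=; apply/eqP/setP=> y.
apply/imsetP/idP => [[x _ ->]|yT]; first by rewrite ffunE enum_valP.
have : enum_rank_in yT y \in g @: setT by rewrite gT inE.
case/imsetP=> x _ E; exists x => //.
by rewrite ffunE -E enum_rankK_in.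
Qed.

Lemma count_ord_maps k :
  #|[set f : {ffun A -> 'I_k} | Phi (ord_of f)]| =
  (\sum_(j < #|A|.+1) c j * 'C(k, j))%N.
Proof.
rewrite -sum1_card (partition_big (fun f : {ffun A -> 'I_k} => f @: setT) xpredT) //=.
transitivity (\sum_(T : {set 'I_k}) c #|T|)%N.
  apply: eq_bigr => T _; rewrite -card_onto -sum1_card.
  by apply: eq_bigl => f; rewrite !inE.
transitivity (\sum_(T : {set 'I_k}) \sum_(j < #|A|.+1 | j == #|T| :> nat) c j)%N.
  apply: eq_bigr => T _; case: (ltnP #|T| #|A|.+1) => TA.
    by rewrite (big_pred1 (Ordinal TA)).
  rewrite c_gt // big1 // => j /eqP jT.
  by have := ltn_ord j; rewrite jT ltnNge TA.
rewrite (exchange_big_dep xpredT) //=; apply: eq_bigr => j _.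
rewrite sum_nat_const mulnC; congr muln.
rewrite -[k in RHS]card_ord -card_draws.
by apply: eq_card => T; rewrite !inE unfold_in eq_sym.
Qed.

Lemma count_poly (K : fieldType) : [pchar K] =i pred0 ->
  {p : {poly K} | forall k, (0 < k)%N -> p.[k%:R] =
     #|[set f : {ffun A -> 'I_k} | Phi (ord_of f)]|%:R}.
Proof.
move=> /pcharf0P K0; have fact_neq0 j : j`!%:R != 0 :> K.
  by rewrite K0 -lt0n fact_gt0.
have ffactE k j : \prod_(i < j) (k%:R - i%:R) = (k ^_ j)%:R :> K.
  elim: j => [|j IH]; first by rewrite big_ord0.
  rewrite big_ord_recr /= IH ffactnSr natrM; case: (leqP j k) => [jk|kj].
    by rewrite natrB.
  by rewrite ffact_small // !mul0r.
exists (\sum_(j < #|A|.+1)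
  ((c j)%:R / j`!%:R) *: \prod_(i < j) ('X - i%:R%:P)) => k _.
rewrite count_ord_maps natr_sum horner_sum; apply: eq_bigr => j _.
rewrite hornerZ horner_prod natrM.
under eq_bigr => i _ do rewrite hornerXsubC.
by rewrite ffactE -bin_ffact natrM [X in _ * X]mulrC mulrA divfK.
Qed.

End Counting.


Section CountingPolynomials.
Variables (K : fieldType) (K0 : [pchar K] =i pred0).

Lemma L_poly (A : finType) (P : qposet A) :
  {p : {poly K} | forall k, (0 < k)%N -> p.[k%:R] = #|L_maps P k|%:R}.
Proof.
pose Phi (r : {ffun A * A -> bool}) :=
  [forall i, forall j, le_qp P i j ==> r (i, j)].
have [p pP] := count_poly Phi K0; exists p => k /pP ->; congr _%:R.
rewrite -!sum1_card; apply: eq_bigl => f; rewrite !inE.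
by apply: eq_forallb => i; apply: eq_forallb => j; rewrite ffunE.
Qed.

Lemma Lstr_poly (A : finType) (P : qposet A) :
  {p : {poly K} | forall k, (0 < k)%N -> p.[k%:R] = #|Lstr_maps P k|%:R}.
Proof.
pose Phi (r : {ffun A * A -> bool}) :=
  [forall i, forall j, le_qp P i j ==> r (i, j)] &&
  [forall i, forall j, le_qp P i j && (r (i, j) && r (j, i)) ==> sim_qp P i j].
have [p pP] := count_poly Phi K0; exists p => k /pP ->; congr _%:R.
rewrite -!sum1_card; apply: eq_bigl => f; rewrite !inE; congr andb;
  apply: eq_forallb => i; apply: eq_forallb => j; rewrite !ffunE //=.
by rewrite -eqn_leq.
Qed.

Lemma poly_eq_nat (p q : {poly K}) :
  (forall k, (0 < k)%N -> p.[k%:R] = q.[k%:R]) -> p = q.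
Proof.
move=> pq; apply/eqP; rewrite -subr_eq0; apply/negPn/negP => d0.
pose s := [seq i%:R : K | i <- iota 1 (size (p - q))].
have sI : injective (fun i => i%:R : K).
  move: K0 => /pcharf0P K0' i j; wlog ij : i j / (i <= j)%N => [H e|e].
    by case: (leqP i j) => [|/ltnW] h; [|symmetry]; apply: H.
  apply/eqP; rewrite eqn_leq ij /= -subn_eq0 -K0' natrB // e subrr //.
have : (size s < size (p - q)%R)%N.
  apply: max_poly_roots; rewrite ?d0 ?map_inj_uniq ?iota_uniq //.
  apply/allP=> _ /mapP[i + ->]; rewrite mem_iota => /andP[i0 _].
  by rewrite rootE hornerD hornerN pq // subrr.
by rewrite size_map size_iota ltnn.
Qed.

End CountingPolynomials.

Notation Hqp K := {malg K[qp]}.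

(* H_qp (x) H_qp, with basis the pairs of isoclasses *)
Notation Hqp2 K := {malg K[(qp * qp)%type]}.

Section Bialgebras.
Variable K : fieldType.

Definition linext (V : lmodType K) (f : qp -> V) (x : Hqp K) : V :=
  \sum_(p <- msupp x) x@_p *: f p.

Lemma linextU (V : lmodType K) (f : qp -> V) p : linext f << p >> = f p.
Proof.
by rewrite /linext msuppU oner_eq0 big_seq_fset1 mcoeffUU scale1r.
Qed.

Definition Delta_on (A : finType) (P : qposet A) : Hqp2 K :=
  \sum_(O : {set A} | open_qp P O)
     << (isoclass (restr_qp P (~: O)), isoclass (restr_qp P O)) >>.

Definition delta_on (A : finType) (P : qposet A) : Hqp2 K :=
  \sum_(E : equivalence A | admissible P E)
     << (isoclass (contract_equiv P E), isoclass (restr_equiv P E)) >>.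

Definition Delta : Hqp K -> Hqp2 K := linext (fun p => Delta_on (repr_qp p)).

Definition delta : Hqp K -> Hqp2 K := linext (fun p => delta_on (repr_qp p)).

Lemma Delta_isoclass (A : finType) (P : qposet A) :
  Delta << isoclass P >> = Delta_on P.
Proof.
rewrite /Delta linextU; have /iso_qpP[f [g fK gK] fP] := iso_repr_qp P.
exact: (sum_open_inv fK gK fP (fun p q => << (p, q) >> : Hqp2 K)).
Qed.

Lemma delta_isoclass (A : finType) (P : qposet A) :
  delta << isoclass P >> = delta_on P.
Proof.
rewrite /delta linextU; have /iso_qpP[f [g fK gK] fP] := iso_repr_qp P.
exact: (sum_admissible_inv fK gK fP (fun p q => << (p, q) >> : Hqp2 K)).
Qed.

Lemma cl_isoclass (A : finType) (P : qposet A) : cl (isoclass P) = cl_on P.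
Proof.
have /iso_qpP[f [g fK gK] fP] := iso_repr_qp P; exact: cl_on_inv fK gK fP.
Qed.

(* Counit of Delta: the coefficient of the empty quasi-poset *)
Definition counit_Delta (x : Hqp K) : K := x@_(mone : qp).

(* For a bilinear map t : V -> W -> T, the linear map t o (f (x) g) on        *)
(* H_qp (x) H_qp                                                              *)
Definition tensor_map (V W : lmodType K) (T : nmodType) (t : V -> W -> T)
    (f : Hqp K -> V) (g : Hqp K -> W) (z : Hqp2 K) : T :=
  \sum_(u <- msupp z) t (z@_u *: f << u.1 >>) (g << u.2 >>).

(* K[X] (x) K[X] is {poly {poly K}}, with X (x) 1 = 'X and 1 (x) X = 'Y; the  *)
(* coproduct of K[X] is then poly_XaY, that is p |-> p(X + Y), and its counit *)
(* is evaluation at 0.                                                        *)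
Definition tensor_poly (p q : {poly K}) : {poly {poly K}} := p^:P * q%:P.

(* Bialgebra morphisms preserve antipodes automatically. *)
Definition hopf_morphism (phi : {lrmorphism Hqp K -> {poly K}}) : Prop :=
  (forall x, poly_XaY (phi x) = tensor_map tensor_poly phi phi (Delta x)) /\
  (forall x, (phi x).[0] = counit_Delta x).

Definition homogeneous (phi : Hqp K -> {poly K}) : Prop :=
  forall (n : nat) (x : Hqp K), (forall p, p \in msupp x -> cl p = n) ->
    exists c : K, phi x = c *: 'X^n.

Definition character : Type := {lrmorphism Hqp K -> K^o}.

(* phi <- lambda, through the canonical identification of K[X] (x) K with     *)
(* K[X]                                                                       *)
Definition act (phi : Hqp K -> {poly K}) (lambda : character) :
  Hqp K -> {poly K} :=
  fun x => tensor_map (fun (q : {poly K}) (c : K^o) => (c : K) *: q)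
             phi lambda (delta x).

Hypothesis K0 : [pchar K] =i pred0.

Definition ehr : Hqp K -> {poly K} :=
  linext (fun p => sval (L_poly K0 (repr_qp p))).

Definition ehrstr : Hqp K -> {poly K} :=
  linext (fun p => sval (Lstr_poly K0 (repr_qp p))).

Lemma ehr_isoclass (A : finType) (P : qposet A) k : (0 < k)%N ->
  (ehr << isoclass P >>).[k%:R] = #|L_maps P k|%:R.
Proof.
move=> k0; rewrite /ehr linextU (svalP (L_poly K0 _)) //.
have /iso_qpP[f [g fK gK] fP] := iso_repr_qp P.
by rewrite (card_L_inv fK gK fP).
Qed.

Lemma ehrstr_isoclass (A : finType) (P : qposet A) k : (0 < k)%N ->
  (ehrstr << isoclass P >>).[k%:R] = #|Lstr_maps P k|%:R.
Proof.
move=> k0; rewrite /ehrstr linextU (svalP (Lstr_poly K0 _)) //.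
have /iso_qpP[f [g fK gK] fP] := iso_repr_qp P.
by rewrite (card_Lstr_inv fK gK fP).
Qed.

End Bialgebras.

(* Main.v *)
Require Import Defs.
From HB Require Import structures.
From mathcomp Require Import all_boot all_order all_algebra.
From mathcomp Require Import finmap.
From mathcomp.multinomials Require Import monalg.

Import GRing.Theory.
Local Open Scope ring_scope.

(** Every Hopf morphism F to K[X] satisfies a linear differential equation:
    taking the coefficient of Y in F(P)(X + Y) gives
      F(P)' = sum over the open sets O of P of f(O) F(A minus O),
    where f(O) is the coefficient of X in F(O). As f vanishes on the empty
    quasi-poset, the right-hand side only involves smaller quasi-posets, so in
    characteristic zero F is determined by f and by its values at 0
    ([has_generator_inj]). Both the uniqueness of phi0 and the description of
    the order polynomials come from this principle.

    The morphism phi0. A homogeneous morphism sends P to a multiple of X^cl(P).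
    The right factor [lam P] is the number of linear extensions of the poset
    of classes of P divided by cl(P)!, characterized by the recursion
      cl(P) lam(P) = sum over the maximal classes C of lam(P minus C).
    An induction from this recursion gives multiplicativity for disjoint unions
    ([lam_split]) and the identity
      binomial(cl P, k) lam(P) = sum over O with cl(O) = k of
                                 lam(A minus O) lam(O)
    ([lam_binomial]), which is comultiplicativity. Two homogeneous morphisms
    sending every bullet to X have the same generator f, namely the indicator
    of having one class, and are therefore equal.

    The action. Let F be one of the two order polynomials. Cutting a monotone
    map with k + l values at k shows that F(P)(k + l) is the sum over O of
    F(A minus O)(k) F(O)(l) ([card_mono_split]), whence the differential
    equation for F, with generator a(P) the coefficient of X in F(P); it
    vanishes unless P is connected and nonempty, as F is multiplicative and
    F(P)(0) = 0 for nonempty P. Let alpha be the character that agrees with a on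
    connected nonempty quasi-posets, that is, the product of a over the
    connected components. Differentiating the sum over E of
    alpha(P | E) phi0(P / E) marks a maximal class O of P / E, which is an open
    class of E; the pairs (E, O) correspond to a nonempty connected open O of P
    and an admissible equivalence on its complement ([sum_max_class]). So
    phi0 acted on by alpha has generator a as well, and equals F
    ([act_on_generator]). Conversely, on a connected P the coefficient of X in
    phi0 acted on by beta is beta(P) ([act_on_coef1]), because only the total
    equivalence contracts P to a single class; this makes alpha unique. *)

Set Implicit Arguments.
Unset Strict Implicit.
Unset Printing Implicit Defensive.

(** * Linear maps out of the free module on isoclasses *)

Section FreeModule.
Variables (K : fieldType).

Section Morphism.
Variables (S : comAlgType K) (h : qp -> S).
Hypotheses (h1 : h empty_qp = 1)
           (hM : forall p q, h (union_qp p q) = h p * h q).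

Let h_mmorphism : mmorphism h.
Proof. by split; [exact: hM | exact: h1]. Qed.

(** Products of basis elements are basis elements, so being multiplicative on
    the basis is enough. *)
Lemma lrmorphism_of_basis :
  {phi : {lrmorphism Hqp K -> S} | forall p, phi << p >> = h p}.
Proof.
pose hm : {mmorphism qp -> S} :=
  HB.pack h (isMultiplicative.Build _ _ h h_mmorphism).
pose m := mmap (in_alg S) hm.
have mZ : scalable m by move=> c g; rewrite /m mmapZ /= mulr_algl.
have mM : monoid_morphism m by split=> [|x y]; rewrite /m ?rmorph1 ?rmorphM.
have mB : zmod_morphism m by move=> x y; rewrite /m raddfB.
pose phi : {lrmorphism Hqp K -> S} :=
  HB.pack m (GRing.isZmodMorphism.Build _ _ m mB)
    (GRing.isMonoidMorphism.Build _ _ m mM)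
    (GRing.isScalable.Build _ _ _ _ m mZ).
by exists phi => p; rewrite /= /m mmapU /= scale1r mul1r.
Qed.

End Morphism.

Section Supp.
Variables (I : choiceType) (T : nmodType) (F : I -> K -> T).
Hypotheses (F0 : forall i, F i 0 = 0)
           (FD : forall i, {morph F i : a b / a + b}).

(** The shape of [tensor_map]. It is additive because the supports of two
    arguments can be enlarged to a common one: the terms [F i 0] vanish. *)
Definition supp_sum (z : {malg K[I]}) : T := \sum_(i <- msupp z) F i z@_i.

Lemma supp_sumEw (d : {fset I}) z : (msupp z `<=` d)%fset ->
  supp_sum z = \sum_(i <- d) F i z@_i.
Proof.
move=> le; rewrite [LHS](big_fset_incl _ le) => //= i _.
by move=> /mcoeff_outdom ->.
Qed.

Lemma supp_sum0 : supp_sum 0 = 0.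
Proof. by rewrite /supp_sum msupp0 big_seq_fset0. Qed.

Lemma supp_sumD : {morph supp_sum : x y / x + y}.
Proof.
move=> x y; pose d := (msupp x `|` msupp y)%fset.
rewrite !(@supp_sumEw d) ?fsubsetUl ?fsubsetUr ?msuppD_le //.
by rewrite -big_split /=; apply: eq_bigr => i _; rewrite mcoeffD FD.
Qed.

Lemma supp_sumU c i : supp_sum << c *g i >> = F i c.
Proof. by rewrite (supp_sumEw msuppU_le) big_seq_fset1 mcoeffUU. Qed.

Lemma supp_sum_big (J : Type) (r : seq J) (P : pred J) (G : J -> {malg K[I]}) :
  supp_sum (\sum_(j <- r | P j) G j) = \sum_(j <- r | P j) supp_sum (G j).
Proof. exact: (big_morph supp_sum supp_sumD supp_sum0). Qed.

End Supp.

Lemma linext_id (S : lalgType K) (phi : {lrmorphism Hqp K -> S}) x :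
  phi x = linext (fun p => phi << p >>) x.
Proof.
rewrite [x in LHS]monalgE linear_sum; apply: eq_bigr => p _.
by rewrite -linearZ; congr (phi _); apply/malgP=> q;
  rewrite mcoeffZ !mcoeffU mulrnAr mulr1.
Qed.

Lemma eq_linext (V : lmodType K) (f g : qp -> V) :
  f =1 g -> linext f =1 linext g.
Proof. by move=> fg x; apply: eq_bigr => p _; rewrite fg. Qed.

Section Tensor.
Variables (V W : lmodType K) (T : nmodType) (t : V -> W -> T).
Variables (f : Hqp K -> V) (g : Hqp K -> W).
Hypotheses (t0 : forall b, t 0 b = 0)
           (tD : forall b, {morph t^~ b : a a' / a + a'}).

Let F (u : qp * qp) (c : K) := t (c *: f << u.1 >>) (g << u.2 >>).

Let F0 u : F u 0 = 0. Proof. by rewrite /F scale0r t0. Qed.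

Let FD u : {morph F u : a b / a + b}.
Proof. by move=> a b; rewrite /F scalerDl tD. Qed.

Lemma tensor_map_scale_sum (J : finType) (P : pred J) (D : J -> qp * qp)
    (c : K) :
  tensor_map t f g (c *: \sum_(j | P j) (<< D j >> : Hqp2 K)) =
  \sum_(j | P j) t (c *: f << (D j).1 >>) (g << (D j).2 >>).
Proof.
rewrite -[LHS]/(supp_sum F _) scaler_sumr supp_sum_big //.
apply: eq_bigr => j _; apply: etrans (supp_sumU F0 c (D j)).
congr supp_sum; apply/malgP=> u.
by rewrite mcoeffZ !mcoeffU mulrnAr mulr1.
Qed.

Lemma tensor_map_linext (D : qp -> Hqp2 K) (x : Hqp K) :
  tensor_map t f g (linext D x) =
  \sum_(p <- msupp x) tensor_map t f g (x@_p *: D p).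
Proof. by rewrite -[LHS]/(supp_sum F _) /linext supp_sum_big. Qed.

End Tensor.
End FreeModule.

(** * Restrictions to subsets *)

Section IsoVia.
Variables (A B : finType) (X : eqType) (R : X -> X -> bool).
Variables (P : qposet A) (Q : qposet B) (h : A -> X) (g : B -> X).

(** Restrictions, contractions and disjoint unions live on different types.
    Embedding them in a common type [X] reduces an isomorphism to an equality of
    images. *)
Lemma iso_via :
  injective h -> injective g ->
  (forall x, exists y, h x = g y) -> (forall y, exists x, h x = g y) ->
  (forall x y, le_qp P x y = R (h x) (h y)) ->
  (forall x y, le_qp Q x y = R (g x) (g y)) ->
  iso_qp P Q.
Proof.
move=> hI gI hg gh hP gQ.
have hg' x : exists y, h x == g y by have [y ->] := hg x; exists y.
have gh' y : exists x, h x == g y by have [x <-] := gh y; exists x.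
have fP x := eqP (xchooseP (hg' x)); have f'P y := eqP (xchooseP (gh' y)).
apply/iso_qpP; exists (fun x => xchoose (hg' x)).
  exists (fun y => xchoose (gh' y)) => [x|y].
    by apply: hI; rewrite f'P -fP.
  by apply: gI; rewrite -fP f'P.
by move=> x y; rewrite gQ -!fP hP.
Qed.

End IsoVia.

Definition sub_qp (A : finType) (P : qposet A) (B : {set A}) : qp :=
  isoclass (restr_qp P B).

Lemma le_restr (A : finType) (P : qposet A) (B : {set A}) u v :
  le_qp (restr_qp P B) u v = le_qp P (val u) (val v).
Proof. by rewrite mk_qposetE. Qed.

Lemma sub_ex (A : finType) (B : {set A}) x :
  x \in B -> exists u : {y | y \in B}, x = val u.
Proof. by move=> xB; exists (Sub x xB). Qed.

Lemma card_subset_type (A : finType) (B : {set A}) :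
  #|{: {x | x \in B}}| = #|B|.
Proof. by rewrite card_sig; apply: eq_card => x; rewrite inE. Qed.

Section Restriction.
Variables (A : finType) (P : qposet A).
Implicit Types (B C O U : {set A}).

Lemma sub_qp_setT : sub_qp P setT = isoclass P.
Proof.
apply/isoclassP; apply: (@iso_via _ _ _ (le_qp P) _ _ val id) => //.
- exact: val_inj.
- by move=> u; exists (val u).
- by move=> y; have [u ->] := sub_ex (in_setT y); exists u.
- exact: le_restr.
Qed.

Lemma sub_qp_sub_qp B (C : {set {x | x \in B}}) :
  sub_qp (restr_qp P B) C = sub_qp P [set val u | u in C].
Proof.
apply/isoclassP.
apply: (@iso_via _ _ _ (le_qp P) _ _ (fun u => val (val u)) val).
- by move=> u v /val_inj/val_inj.
- exact: val_inj.
- by move=> u; apply: sub_ex; apply: imset_f; apply: valP.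
- move=> v; have /imsetP[w wC ->] := valP v.
  by have [u ->] := sub_ex wC; exists u.
- by move=> u v; rewrite !le_restr.
- exact: le_restr.
Qed.

Definition subpre B C : {set {x | x \in B}} := [set u | val u \in C].

Lemma subpreK B C : C \subset B -> [set val u | u in subpre B C] = C.
Proof.
move=> /subsetP CB; apply/setP=> x; apply/imsetP/idP => [[u + ->]|xC].
  by rewrite inE.
by exists (Sub x (CB x xC)); rewrite ?inE.
Qed.

Lemma imset_valK B (O : {set {x | x \in B}}) :
  subpre B [set val u | u in O] = O.
Proof. by apply/setP=> u; rewrite inE (mem_imset _ _ val_inj). Qed.

Lemma sub_qp_subpre B C : C \subset B ->
  sub_qp (restr_qp P B) (subpre B C) = sub_qp P C.
Proof. by move=> CB; rewrite sub_qp_sub_qp subpreK. Qed.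

Lemma sub_qp_subpreC B C :
  C \subset B -> sub_qp (restr_qp P B) (~: subpre B C) = sub_qp P (B :\: C).
Proof.
move=> CB; have -> : ~: subpre B C = subpre B (B :\: C).
  by apply/setP=> u; rewrite !inE (valP u) andbT.
by rewrite sub_qp_subpre // subsetDl.
Qed.

Lemma open_qpP O :
  reflect (forall i j, i \in O -> le_qp P i j -> j \in O) (open_qp P O).
Proof.
apply: (iffP forallP) => [h i j iO ij|h i].
  by have /forallP/(_ j) := h i; rewrite iO ij.
by apply/forallP=> j; apply/implyP=> iO; apply/implyP; apply: h.
Qed.

(** Open sets of the subspace [B], seen as subsets of [A]: with a fixed ambient
    type, iterated restrictions become set differences. *)
Definition open_in B C := (C \subset B) && open_qp (restr_qp P B) (subpre B C).

Lemma open_inP B C :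
  reflect (C \subset B /\
           forall i j, i \in C -> j \in B -> le_qp P i j -> j \in C)
          (open_in B C).
Proof.
apply: (iffP andP) => -[CB h]; split=> //.
  move=> i j iC jB ij; have iB := subsetP CB i iC.
  have /forallP/(_ (Sub i iB))/forallP/(_ (Sub j jB)) := h.
  by rewrite !inE le_restr /= iC ij.
apply/forallP=> u; apply/forallP=> v; rewrite !inE le_restr.
by apply/implyP=> uC; apply/implyP; apply: h => //; apply: valP.
Qed.

Lemma open_in_setT O : open_in setT O = open_qp P O.
Proof.
apply/open_inP/open_qpP => [[_ h] i j iO|h]; first by apply: h; rewrite ?inE.
by split=> [|i j iO _]; [apply: subsetT | apply: h].
Qed.

(** With the coproduct of a restriction indexed by subsets of [A],
    coassociativity becomes an exchange of sums over subsets of [A]. *)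
Lemma sum_open_restr (V : nmodType) (F : qp -> qp -> V) B :
  \sum_(O | open_qp (restr_qp P B) O)
     F (sub_qp (restr_qp P B) (~: O)) (sub_qp (restr_qp P B) O) =
  \sum_(C | open_in B C) F (sub_qp P (B :\: C)) (sub_qp P C).
Proof.
rewrite (reindex_onto (subpre B) (fun S => val @: S)) /=; last first.
  by move=> O _; rewrite imset_valK.
have CB C : ([set val u | u in subpre B C] == C) = (C \subset B).
  apply/eqP/idP => [<-|/subpreK //].
  by apply/subsetP=> _ /imsetP[u _ ->]; apply: valP.
apply: eq_big => C; first by rewrite CB andbC.
by rewrite CB => /andP[_ CB']; rewrite sub_qp_subpreC ?sub_qp_subpre.
Qed.

End Restriction.

(** * Equivalence classes and relative open sets *)

Section Classes.
Variables (A : finType) (P : qposet A).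
Implicit Types (B C O U V : {set A}).

Lemma sim_refl x : sim_qp P x x.
Proof. by rewrite /sim_qp le_qp_refl. Qed.

Lemma sim_sym x y : sim_qp P x y = sim_qp P y x.
Proof. by rewrite /sim_qp andbC. Qed.

Lemma sim_trans y x z : sim_qp P x y -> sim_qp P y z -> sim_qp P x z.
Proof.
move=> /andP[xy yx] /andP[yz zy]; apply/andP; split.
  exact: le_qp_trans xy yz.
exact: le_qp_trans zy yx.
Qed.

Definition sim_class x := [set y | sim_qp P x y].

Lemma sim_class_eq x y : (sim_class x == sim_class y) = sim_qp P x y.
Proof.
apply/eqP/idP => [/setP/(_ y)|xy]; first by rewrite !inE sim_refl => ->.
apply/setP=> z; rewrite !inE; apply/idP/idP; last exact: sim_trans.
by apply: sim_trans; rewrite sim_sym.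
Qed.

(** The classes are taken in the whole of [A]; as equivalent points have equal
    classes, meeting [B] is all that has to be counted. *)
Definition ncl B := #|sim_class @: B|.

Lemma cl_isoclassT : cl (isoclass P) = ncl setT.
Proof.
rewrite cl_isoclass /cl_on /ncl /equivalence_partition; congr #|pred_of_set _|.
by apply: eq_imset => x; apply/setP=> y; rewrite !inE.
Qed.

Lemma ncl0 : ncl set0 = 0%N.
Proof. by rewrite /ncl imset0 cards0. Qed.

Lemma ncl_eq0 B : (ncl B == 0%N) = (B == set0).
Proof. by rewrite cards_eq0 imset_eq0. Qed.

Lemma ncl_eq1P B :
  reflect (B != set0 /\ {in B &, forall x y, sim_qp P x y}) (ncl B == 1%N).
Proof.
apply: (iffP idP) => [B1|[/set0Pn[x xB] h]].
  split=> [|x y xB yB].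
    by rewrite -ncl_eq0 (eqP B1).
  have /cards1P[S SE] := B1; rewrite -sim_class_eq.
  have inS z : z \in B -> sim_class z = S.
    by move=> zB; apply/set1P; rewrite -SE imset_f.
  by rewrite !inS.
apply/cards1P; exists (sim_class x); apply/setP=> S; rewrite inE.
apply/imsetP/eqP => [[y yB ->]|->]; last by exists x.
by apply/eqP; rewrite sim_class_eq h.
Qed.

Lemma nclU U V : {in U & V, forall x y, ~~ sim_qp P x y} ->
  ncl (U :|: V) = (ncl U + ncl V)%N.
Proof.
move=> UV; rewrite /ncl imsetU cardsU; set I := _ :&: _.
suff -> : I = set0 by rewrite cards0 subn0.
apply/eqP; rewrite -subset0; apply/subsetP=> S.
rewrite inE => /andP[/imsetP[x xU ->] /imsetP[y yV] /eqP].
by rewrite sim_class_eq (negbTE (UV _ _ _ _)).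
Qed.

(** Open sets are unions of classes. *)
Lemma ncl_open_in B C : open_in P B C -> ncl B = (ncl C + ncl (B :\: C))%N.
Proof.
move=> /open_inP[CB h]; rewrite -nclU; last first.
  move=> x y xC; rewrite inE => /andP[yC yB]; apply: contra yC => /andP[xy _].
  exact: h xy.
by rewrite setUC -{2}(setIidPr CB) setUC setID.
Qed.

End Classes.

Lemma cl_sub_qp (A : finType) (P : qposet A) (B : {set A}) :
  cl (sub_qp P B) = ncl P B.
Proof.
have sr u v : sim_qp (restr_qp P B) u v = sim_qp P (val u) (val v).
  by rewrite /sim_qp !le_restr.
rewrite cl_isoclassT /ncl.
rewrite -(card_in_imset (f := subpre B) (D := mem (sim_class P @: B))).
  congr #|pred_of_set _|; apply/setP=> S; apply/imsetP/imsetP.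
    case=> u _ ->; exists (sim_class P (val u)); first by apply/imset_f/valP.
    by apply/setP=> v; rewrite !inE sr.
  case=> _ /imsetP[x xB ->] ->; exists (Sub x xB) => //.
  by apply/setP=> v; rewrite !inE sr.
move=> _ _ /imsetP[x xB ->] /imsetP[y yB ->] /setP/(_ (Sub y yB)).
by rewrite !inE /= sim_refl => xy; apply/eqP; rewrite sim_class_eq.
Qed.

Section RelativeOpen.
Variables (A : finType) (P : qposet A).
Implicit Types (B C O U V : {set A}).

Lemma open_in_sub B U C :
  open_in P B U -> open_in P U C = open_in P B C && (C \subset U).
Proof.
move=> /open_inP[UB hU]; apply/open_inP/andP => [[CU hC]|[/open_inP[CB hC] CU]].
  split=> //; apply/open_inP; split; first exact: subset_trans CU UB.
  move=> i j iC jB ij; apply: hC (ij) => //; apply: hU (ij) => //.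
  exact: (subsetP CU).
by split=> // i j iC jU ij; apply: hC ij => //; apply: (subsetP UB).
Qed.

Lemma open_in_setD B U C : open_in P B U -> open_in P (B :\: C) (U :\: C).
Proof.
move=> /open_inP[UB h]; apply/open_inP; split; first exact: setSD.
move=> i j; rewrite !inE => /andP[_ iU] /andP[-> jB] ij /=.
exact: h ij.
Qed.

(** Equivalent points belong to the same open sets. *)
Lemma open_in_class B U C :
  ncl P C == 1%N -> C \subset B -> open_in P B U -> open_in P B (B :\: U) ->
  (C \subset B :\: U) = ~~ (C \subset U).
Proof.
move=> /ncl_eq1P[/set0Pn[x xC] h] /subsetP CB /open_inP[UB hU] /open_inP[_ hV].
apply/idP/idP => [/subsetP CV|nCU].
  by apply/subsetPn; exists x => //; have := CV x xC; rewrite inE => /andP[].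
have [y yC yU] := subsetPn nCU; apply/subsetP=> z zC.
have /andP[yz _] := h y z yC zC.
by apply: (hV y) => //; rewrite ?inE ?yU ?CB.
Qed.

(** Through [O' = O :\: C], the open sets of [B] that contain a given open [C]
    correspond to the open sets of [B :\: C]. *)
Lemma open_in_setU B C O :
  open_in P B C -> C \subset O ->
  open_in P B O = open_in P (B :\: C) (O :\: C) && (O \subset B).
Proof.
move=> BC CO; have /open_inP[CB hC] := BC.
apply/idP/andP => [BO|[/open_inP[_ h] OB]].
  split; first exact: open_in_setD.
  by have /open_inP[] := BO.
apply/open_inP; split=> // i j iO jB ij.
have [jC|njC] := boolP (j \in C); first exact: (subsetP CO).
have niC : i \notin C by apply: contra njC => iC; apply: hC ij.
have : j \in O :\: C by apply: h ij; rewrite inE ?niC ?njC.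
by rewrite inE => /andP[].
Qed.

End RelativeOpen.

(** * Normalized number of linear extensions *)

Section Lambda.
Variables (K : fieldType) (K0 : [pchar K] =i pred0).

Let natr_eq0 n : (n%:R == 0 :> K) = (n == 0%N).
Proof. by move/pcharf0P: K0. Qed.

(** An open set with a single class is a maximal class, and removing it removes
    the last element of a linear extension. *)
Fixpoint lam_iter (n : nat) (p : qp) : K :=
  if n isn't m.+1 then 1 else
  n%:R^-1 *
  \sum_(O | open_qp (repr_qp p) O && (cl (sub_qp (repr_qp p) O) == 1%N))
     lam_iter m (sub_qp (repr_qp p) (~: O)).

Definition lam (p : qp) : K := lam_iter (cl p) p.

Section Recursion.
Variables (A : finType) (P : qposet A).
Implicit Types (B C O U : {set A}).

Lemma lam_recursion :
  (cl (isoclass P))%:R * lam (isoclass P) =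
  \sum_(O | open_qp P O && (cl (sub_qp P O) == 1%N)) lam (sub_qp P (~: O)).
Proof.
set p := isoclass P; pose F q q' := if cl q' == 1%N then lam q else 0.
have /iso_qpP[f [g fK gK] fP] := iso_repr_qp P.
have /esym := sum_open_inv fK gK fP F.
rewrite -!big_mkcondr => /= ->.
rewrite /lam; case E : (cl p) => [|n] /=; last first.
  rewrite mulrA mulfV ?natr_eq0 // mul1r; apply: eq_bigr => O /andP[oO /eqP cO].
  congr lam_iter; apply: succn_inj; rewrite -/p in E |- *.
  rewrite -E -{1}[p]repr_qpK cl_isoclassT.
  by rewrite (ncl_open_in (C := O)) ?open_in_setT // -setTD -!cl_sub_qp cO.
rewrite mul0r big1 // => O /andP[_ /eqP].
rewrite cl_sub_qp => c1; move: E; rewrite -[p]repr_qpK cl_isoclassT.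
move/eqP; rewrite ncl_eq0 => /eqP/setP E.
have /ncl_eq1P[/set0Pn[x]] : ncl (repr_qp (isoclass P)) O == 1%N by apply/eqP.
by have := E x; rewrite !inE.
Qed.

End Recursion.

Section Subsets.
Variables (A : finType) (P : qposet A).
Implicit Types (B C O U : {set A}).

Lemma lam_sub_qp B :
  (ncl P B)%:R * lam (sub_qp P B) =
  \sum_(C | open_in P B C && (ncl P C == 1%N)) lam (sub_qp P (B :\: C)).
Proof.
rewrite -cl_sub_qp lam_recursion.
pose F q q' := if cl q' == 1%N then lam q else 0.
rewrite big_mkcondr (sum_open_restr P F B) /F -big_mkcondr.
by apply: eq_bigl => C; rewrite cl_sub_qp.
Qed.

Lemma lam_sub_qp0 : lam (sub_qp P set0) = 1.
Proof. by rewrite /lam cl_sub_qp ncl0. Qed.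

Lemma lam_cl1 B : ncl P B = 1%N -> lam (sub_qp P B) = 1.
Proof.
move=> B1; have := lam_sub_qp B; rewrite B1 mul1r => ->.
have /ncl_eq1P[B0 hB] : ncl P B == 1%N by rewrite B1.
rewrite (big_pred1 B) => [|C]; first by rewrite setDv lam_sub_qp0.
apply/andP/eqP => [[/open_inP[CB h] /ncl_eq1P[/set0Pn[x xC] _]]|->].
  apply/eqP; rewrite eqEsubset CB; apply/subsetP=> y yB.
  by have /andP[xy _] := hB x y (subsetP CB _ xC) yB; apply: h xy.
by rewrite B1; split=> //; apply/open_inP.
Qed.

(** The last class of a linear extension lies in exactly one of the two parts,
    so both sides obey the same recursion. *)
Lemma lam_split B U : open_in P B U -> open_in P B (B :\: U) ->
  lam (sub_qp P B) = lam (sub_qp P U) * lam (sub_qp P (B :\: U)).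
Proof.
have [n] := ubnP #|B|; elim: n B U => // n IH B U /ltnSE leB BU BV.
(* The maximal classes of [B] contained in one of the two parts. *)
have half W : open_in P B W -> open_in P B (B :\: W) ->
  \sum_(C | open_in P B C && (ncl P C == 1%N) && (C \subset W))
     lam (sub_qp P (B :\: C)) =
  (ncl P W)%:R * (lam (sub_qp P W) * lam (sub_qp P (B :\: W))).
  move=> BW BW'; rewrite mulrA lam_sub_qp mulr_suml; apply: eq_big => C.
    by rewrite (open_in_sub _ BW) andbAC.
  move=> /andP[/andP[BC /ncl_eq1P[/set0Pn[x xC] _]] CW].
  have /open_inP[CB _] := BC.
  have ED : B :\: C :\: (W :\: C) = B :\: W.
    apply/setP=> y; rewrite !inE negb_and negbK; case: (boolP (y \in C)) => //=.
    by move=> yC; rewrite (subsetP CW _ yC).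
  rewrite (IH (B :\: C) (W :\: C)) ?ED //.
  - apply: leq_trans leB; apply: proper_card; apply/properP.
    split; first exact: subsetDl.
    by exists x; rewrite ?inE ?xC //; apply: (subsetP CB).
  - exact: open_in_setD.
  - have -> : B :\: W = (B :\: W) :\: C.
      by rewrite setDDl (setUidPl CW).
    exact: open_in_setD.
have [B0|B0] := boolP (ncl P B == 0%N).
  move: B0; rewrite ncl_eq0 => /eqP B0; subst B.
  have /open_inP[+ _] := BU; rewrite subset0 => /eqP ->.
  by rewrite setDv lam_sub_qp0 mulr1.
apply: (@mulfI _ (ncl P B)%:R); rewrite ?natr_eq0 //.
rewrite lam_sub_qp (bigID (fun C => C \subset U)) /= half //.
rewrite (eq_bigl (fun C => open_in P B C && (ncl P C == 1%N) &&
    (C \subset B :\: U))); last first.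
  move=> C; apply: andb_id2l => /andP[BC C1].
  by rewrite (open_in_class C1 _ BU BV) //; case/open_inP: BC.
have DD : B :\: (B :\: U) = U.
  by rewrite setDDr setDv set0U; apply/setIidPr; case/open_inP: BU.
rewrite half ?DD // (ncl_open_in BU) natrD mulrDl; congr (_ + _).
by congr (_ * _); rewrite mulrC.
Qed.

(** Induction on [k]. In the step, mark a maximal class [C] of [O]: it is a
    maximal class of [B] too, so exchanging the two sums leads to [B :\: C]
    and [k]. *)
Lemma lam_binomial B k :
  'C(ncl P B, k)%:R * lam (sub_qp P B) =
  \sum_(O | open_in P B O && (ncl P O == k))
     lam (sub_qp P (B :\: O)) * lam (sub_qp P O).
Proof.
elim: k B => [|k IH] B.
  rewrite bin0 mul1r (big_pred1 set0) => [|O].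
    by rewrite setD0 lam_sub_qp0 mulr1.
  rewrite ncl_eq0; apply/andP/eqP => [[_ /eqP]//|->]; split=> //.
  by apply/open_inP; split=> [|i j]; rewrite ?sub0set ?inE.
apply: (@mulfI _ k.+1%:R); rewrite ?natr_eq0 //.
rewrite mulrA -natrM mulrC; case: (posnP (ncl P B)) => [B0|Bgt0].
  rewrite B0 muln0 mulr0 big1 ?mulr0 // => O /andP[BO /eqP O1].
  by have := ncl_open_in BO; rewrite B0 O1.
rewrite -[ncl P B]prednK // -mul_bin_diag prednK // natrM mulrC.
rewrite [_%:R * _%:R]mulrC -mulrA lam_sub_qp !mulr_sumr.
transitivity (\sum_(C | open_in P B C && (ncl P C == 1%N))
   \sum_(O | open_in P (B :\: C) O && (ncl P O == k))
      lam (sub_qp P (B :\: C :\: O)) * lam (sub_qp P O)).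
  apply: eq_bigr => C /andP[BC /eqP C1]; rewrite -IH.
  by rewrite (ncl_open_in BC) C1.
transitivity (\sum_(O | open_in P B O && (ncl P O == k.+1))
   \sum_(C | open_in P O C && (ncl P C == 1%N))
      lam (sub_qp P (B :\: O)) * lam (sub_qp P (O :\: C))); last first.
  apply: eq_bigr => O /andP[BO /eqP O1].
  by rewrite mulrCA -O1 lam_sub_qp mulr_sumr.
rewrite [RHS](exchange_big_dep (fun C => open_in P B C && (ncl P C == 1%N))) /=.
  apply: eq_bigr => C /andP[BC C1].
  have /open_inP[CB _] := BC.
  rewrite [RHS](reindex_onto (fun O => O :|: C) (fun O => O :\: C)) /=;
    last first.
    move=> O /andP[/andP[BO _] /andP[/open_inP[CO _] _]].
    by rewrite setUC -{1}(setIidPr CO) setID.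
  apply: eq_big => O; last first.
    move=> /andP[/open_inP[OBC _] _].
    have -> : (O :|: C) :\: C = O.
      rewrite setDUl setDv setU0; apply/setDidPl.
      by apply: disjointWl OBC _;
        rewrite disjoint_sym disjoints_subset setCD subsetUr.
    by rewrite setDDl [C :|: O]setUC.
  have OE : ((O :|: C) :\: C == O) = [disjoint O & C].
    by rewrite setDUl setDv setU0; apply/eqP/setDidPl.
  rewrite OE.
  apply/andP/andP => [[BCO O1]|[/andP[/andP[BO O1] /andP[OC _]] d]].
    have /open_inP[OBC _] := BCO.
    have d : [disjoint O & C].
      by apply: disjointWl OBC _;
        rewrite disjoint_sym disjoints_subset setCD subsetUr.
    have ED : (O :|: C) :\: C = O by apply/eqP; rewrite OE.
    have OB : O :|: C \subset B.
      by rewrite subUset CB andbT (subset_trans OBC) ?subsetDl.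
    have BO : open_in P B (O :|: C).
      by rewrite (open_in_setU BC) ?subsetUr // ED BCO.
    have OC : open_in P (O :|: C) C by rewrite (open_in_sub _ BO) BC subsetUr.
    by rewrite BO OC C1 d (ncl_open_in OC) ED (eqP C1) (eqP O1) add1n eqxx.
  have ED : (O :|: C) :\: C = O by apply/eqP; rewrite OE.
  move: O1; rewrite (ncl_open_in OC) ED (eqP C1) eqSS => ->.
  by move: BO; rewrite (open_in_setU BC) ?subsetUr // ED => /andP[].
move=> O C /andP[BO _] /andP[+ ->]; rewrite (open_in_sub _ BO).
by case/andP=> ->.
Qed.

End Subsets.

End Lambda.

(** * Clopen subsets and disjoint unions *)

Definition clopen (A : finType) (P : qposet A) (O : {set A}) :=
  open_qp P O && open_qp P (~: O).

Definition inl_set (A B : finType) : {set A + B} :=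
  [set u | if u is inl _ then true else false].
Arguments inl_set : clear implicits.

Section Sums.
Variables (A B : finType) (P : qposet A) (Q : qposet B).

Lemma clopen_inl : clopen (sum_qp P Q) (inl_set A B).
Proof.
by apply/andP; split; apply/open_qpP => -[x|x] [y|y]; rewrite !inE ?mk_qposetE.
Qed.

Lemma sub_qp_inl : sub_qp (sum_qp P Q) (inl_set A B) = isoclass P.
Proof.
apply/isoclassP.
apply: (@iso_via _ _ _ (le_qp (sum_qp P Q)) _ _ val inl).
- exact: val_inj.
- by move=> x y [].
- by move=> [[x|x] xU]; [exists x | have := xU; rewrite !inE].
- move=> y; have /sub_ex[u] : inl y \in inl_set A B by rewrite inE.
  by exists u.
- by move=> u v; rewrite le_restr.
- by move=> x y; rewrite mk_qposetE.
Qed.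

Lemma sub_qp_inr : sub_qp (sum_qp P Q) (~: inl_set A B) = isoclass Q.
Proof.
apply/isoclassP.
apply: (@iso_via _ _ _ (le_qp (sum_qp P Q)) _ _ val inr).
- exact: val_inj.
- by move=> x y [].
- by move=> [[x|x] xU]; [have := xU; rewrite !inE | exists x].
- move=> y; have /sub_ex[u] : inr y \in ~: inl_set A B by rewrite !inE.
  by exists u.
- by move=> u v; rewrite le_restr.
- by move=> x y; rewrite mk_qposetE.
Qed.

End Sums.

Section SplitVal.
Variables (A : finType) (O : {set A}).

Definition split_val (u : {x | x \in O} + {x | x \in ~: O}) : A :=
  match u with inl x => val x | inr x => val x end.

Lemma split_val_inj : injective split_val.
Proof.
move=> [u|u] [v|v]; rewrite /split_val => uv; try by congr (_ _); apply: val_inj.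
  by have : val v \in ~: O := valP v; rewrite inE -uv (valP u).
by have : val u \in ~: O := valP u; rewrite inE uv (valP v).
Qed.

Lemma split_val_surj x : exists u, split_val u = x.
Proof.
have [xO|xO] := boolP (x \in O); first by exists (inl (Sub x xO)).
have xC : x \in ~: O by rewrite inE.
by exists (inr (Sub x xC)).
Qed.

End SplitVal.

(** No point of a clopen set is comparable to a point of its complement. *)
Lemma union_clopen (A : finType) (P : qposet A) (O : {set A}) :
  clopen P O -> isoclass P = union_qp (sub_qp P O) (sub_qp P (~: O)).
Proof.
move=> /andP[/open_qpP oO /open_qpP oC]; rewrite union_isoclass.
apply/isoclassP/iso_qp_sym.
apply: (@iso_via _ _ _ (le_qp P) _ _ (@split_val _ O) id) => //.
- exact: split_val_inj.
- by move=> u; exists (split_val u).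
- exact: split_val_surj.
- move=> [u|u] [v|v]; rewrite mk_qposetE /= ?le_restr //; apply/esym/negbTE.
    by have : val v \in ~: O := valP v; rewrite inE; apply: contra; apply/oO/valP.
  apply/negP=> uv; have := oC _ _ (valP u) uv.
  by rewrite inE (valP v).
Qed.

(** A disjoint union is split by the copy of its first summand, so
    multiplicativity can be tested on clopen subsets, inside a single type. *)
Lemma union_mult (R : pzSemiRingType) (h : qp -> R) :
  (forall (A : finType) (P : qposet A) (O : {set A}), clopen P O ->
     h (isoclass P) = h (sub_qp P O) * h (sub_qp P (~: O))) ->
  forall p q, h (union_qp p q) = h p * h q.
Proof.
move=> hP p q; rewrite -[p]repr_qpK -[q]repr_qpK union_isoclass.
by rewrite (hP _ _ _ (clopen_inl _ _)) sub_qp_inl sub_qp_inr.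
Qed.

Lemma clopen_in_setT (A : finType) (P : qposet A) O : clopen P O ->
  open_in P setT O /\ open_in P setT (setT :\: O).
Proof. by rewrite setTD !open_in_setT => /andP. Qed.

Lemma cl_clopen (A : finType) (P : qposet A) (O : {set A}) : clopen P O ->
  cl (isoclass P) = (cl (sub_qp P O) + cl (sub_qp P (~: O)))%N.
Proof.
case/clopen_in_setT=> oO _.
by rewrite !cl_sub_qp cl_isoclassT (ncl_open_in oO) setTD.
Qed.

Lemma qp_of_card0 (A : finType) (P : qposet A) :
  #|A| = 0%N -> isoclass P = empty_qp.
Proof.
move=> A0; have nA (x : A) : False by have := card0_eq A0 x.
apply/isoclassP/iso_qpP.
exists (fun x => match nA x return 'I_0 with end); last by move=> x; case: (nA x).
by exists (fun i : 'I_0 => match notF (ltn_ord i) with end) => [x|[]] //;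
  case: (nA x).
Qed.

Lemma sub_qp0 (A : finType) (P : qposet A) : sub_qp P set0 = empty_qp.
Proof. by apply: qp_of_card0; rewrite card_subset_type cards0. Qed.

Lemma cl_empty : cl empty_qp = 0%N.
Proof. by rewrite -(sub_qp0 (total_qp 'I_0)) cl_sub_qp ncl0. Qed.

Lemma cl_eq0 p : (cl p == 0%N) = (p == empty_qp).
Proof.
apply/eqP/eqP => [|->]; last exact: cl_empty.
rewrite -[p]repr_qpK cl_isoclassT => /eqP; rewrite ncl_eq0 => /eqP E.
by rewrite -sub_qp_setT E sub_qp0.
Qed.

(** A quasi-poset with one class is determined by its cardinality. *)
Lemma cl_eq1 p : cl p = 1%N -> exists2 n, (0 < n)%N & p = bullet n.
Proof.
rewrite -[p]repr_qpK cl_isoclassT => /eqP/ncl_eq1P[/set0Pn[x _] h].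
exists (tag (repr p)); first by case: (tag (repr p)) x => [[]|].
congr isoclass; apply/val_inj; apply/ffunP=> -[y z].
by have /andP[] := h y z (in_setT _) (in_setT _); rewrite /le_qp ffunE /= => ->.
Qed.

Lemma cl_bullet n : (0 < n)%N -> cl (bullet n) = 1%N.
Proof.
case: n => // n _; rewrite cl_isoclassT; apply/eqP/ncl_eq1P.
by split=> [|x y _ _]; [apply/set0Pn; exists ord0 | rewrite /sim_qp !mk_qposetE].
Qed.

(** * Infinitesimal generators and the homogeneous morphism *)

Section Characterization.
Variables (K : fieldType) (K0 : [pchar K] =i pred0).

Lemma deriv_inj0 (p q : {poly K}) : p^`() = q^`() -> p.[0] = q.[0] -> p = q.
Proof.
move=> /polyP pq; rewrite !horner_coef0 => pq0; apply/polyP=> -[//|i].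
have := pq i; rewrite !coef_deriv -mulr_natr -[RHS]mulr_natr.
by apply: mulIf; have /pcharf0P-> := K0.
Qed.

(** This says that F is the exponential of f X in the convolution algebra,
    written as a differential equation in X. *)
Definition has_generator (f : qp -> K) (F : qp -> {poly K}) : Prop :=
  forall (A : finType) (P : qposet A),
    (F (isoclass P))^`() =
    \sum_(O | open_qp P O) f (sub_qp P O) *: F (sub_qp P (~: O)).

(** The term of the empty open set vanishes, so the derivative at [P] involves
    smaller quasi-posets only, and a polynomial is determined by its derivative
    and its value at 0. *)
Lemma has_generator_inj (f : qp -> K) (F G : qp -> {poly K}) :
  f empty_qp = 0 -> has_generator f F -> has_generator f G ->
  (forall p, (F p).[0] = (G p).[0]) -> F =1 G.
Proof.
move=> f0 dF dG FG0 p; rewrite -[p]repr_qpK.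
suff H n (A : finType) (P : qposet A) : (#|A| < n)%N ->
    F (isoclass P) = G (isoclass P) by exact: H (ltnSn _).
elim: n A P => // n IH A P /ltnSE leA.
apply: deriv_inj0 (FG0 _); rewrite dF dG; apply: eq_bigr => O _.
have [->|[x xO]] := set_0Vmem O; first by rewrite sub_qp0 f0 !scale0r.
rewrite [F _]IH // card_subset_type; apply: leq_trans leA.
rewrite -cardsT; apply: proper_card; apply/properP.
by split; [apply: subsetT | exists x; rewrite ?inE ?xO].
Qed.

Lemma coef1_shift (p : {poly K}) (c : K) : (p \Po (c%:P + 'X))`_1 = p^`().[c].
Proof.
have -> (q : {poly K}) : q`_1 = q^`().[0].
  by rewrite horner_coef0 coef_deriv mulr1n.
rewrite deriv_comp derivD derivC derivX add0r mulr1 horner_comp.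
by rewrite !hornerE.
Qed.

(** Compare the coefficients of X on both sides, for infinitely many [k]. *)
Lemma has_generator_shift (F : qp -> {poly K}) :
  (forall (A : finType) (P : qposet A) k, (0 < k)%N ->
     F (isoclass P) \Po (k%:R%:P + 'X) =
     \sum_(O | open_qp P O) (F (sub_qp P (~: O))).[k%:R] *: F (sub_qp P O)) ->
  has_generator (fun p => (F p)`_1) F.
Proof.
move=> FP A P; apply: (poly_eq_nat K0) => k k0.
rewrite -coef1_shift FP // coef_sum horner_sum; apply: eq_bigr => O _.
by rewrite coefZ hornerZ mulrC.
Qed.

(** Evaluating the first variable at the integer [k] turns comultiplicativity
    into the formula of [has_generator_shift]. *)
Lemma hopf_generator (phi : {lrmorphism Hqp K -> {poly K}}) :
  hopf_morphism phi ->
  has_generator (fun p => (phi << p >>)`_1) (fun p => phi << p >>).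
Proof.
move=> [phiD _]; apply: has_generator_shift => A P k _.
rewrite -horner_poly_XaY phiD Delta_isoclass -[Delta_on _ _]scale1r.
rewrite tensor_map_scale_sum ?horner_sum; last 2 first.
- by move=> b; rewrite /tensor_poly rmorph0 mul0r.
- by move=> b a a'; rewrite /tensor_poly rmorphD mulrDl.
apply: eq_bigr => O _; rewrite /tensor_poly scale1r hornerM hornerC horner_map /=.
by rewrite mul_polyC.
Qed.

End Characterization.

Section Phi0.
Variables (K : fieldType) (K0 : [pchar K] =i pred0).
Local Notation lam := (@lam K).

Lemma lam_clopen (A : finType) (P : qposet A) (O : {set A}) : clopen P O ->
  lam (isoclass P) = lam (sub_qp P O) * lam (sub_qp P (~: O)).
Proof.
by case/clopen_in_setT=> oO oC; rewrite -sub_qp_setT (lam_split K0 oO oC) setTD.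
Qed.

Lemma lam_union p q : lam (union_qp p q) = lam p * lam q.
Proof. by move: p q; apply: union_mult => A P O; apply: lam_clopen. Qed.

Lemma cl_union p q : cl (union_qp p q) = (cl p + cl q)%N.
Proof.
rewrite -[p]repr_qpK -[q]repr_qpK union_isoclass.
by rewrite (cl_clopen (clopen_inl _ _)) sub_qp_inl sub_qp_inr.
Qed.

Lemma lam_empty : lam empty_qp = 1.
Proof. by rewrite -(sub_qp0 (total_qp 'I_0)) lam_sub_qp0. Qed.

Definition phi0_on (p : qp) : {poly K} := lam p *: 'X^(cl p).

Lemma phi0_on_union p q : phi0_on (union_qp p q) = phi0_on p * phi0_on q.
Proof.
by rewrite /phi0_on lam_union cl_union exprD -scalerAl -scalerAr scalerA.
Qed.

Lemma phi0_on_empty : phi0_on empty_qp = 1.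
Proof. by rewrite /phi0_on lam_empty cl_empty scale1r. Qed.

Definition phi0 : {lrmorphism Hqp K -> {poly K}} :=
  sval (lrmorphism_of_basis phi0_on_empty phi0_on_union).

Lemma phi0U p : phi0 << p >> = phi0_on p.
Proof. exact: svalP (lrmorphism_of_basis phi0_on_empty phi0_on_union) p. Qed.

(** Both sides are homogeneous of degree [cl P]; the open sets with [i] classes
    account for the [i]-th term of the binomial expansion. The scalar [c] is
    there for the extension to linear combinations. *)
Lemma phi0_on_coproduct (c : K) (A : finType) (P : qposet A) :
  poly_XaY (c *: phi0_on (isoclass P)) =
  \sum_(O | open_qp P O) 
     tensor_poly (c *: phi0_on (sub_qp P (~: O))) (phi0_on (sub_qp P O)).
Proof.
set n := cl (isoclass P).
have oT O : open_qp P O -> open_in P setT O by rewrite open_in_setT.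
pose m i (a : K) : {poly {poly K}} := a%:P%:P * ('X^(n - i) * 'Y ^+ i).
have mD i : {morph m i : a b / a + b}.
  by move=> a b; rewrite /m !polyCD mulrDl.
have m0 i : m i 0 = 0 by rewrite /m !polyC0 mul0r.
transitivity (\sum_(O | open_qp P O)
    m (cl (sub_qp P O)) (c * (lam (sub_qp P (~: O)) * lam (sub_qp P O)))).
  (* An open set has at most [n] classes, so [inord] is faithful here. *)
  rewrite (partition_big (fun O => inord (cl (sub_qp P O)) : 'I_n.+1) xpredT) //=.
  rewrite scalerA /poly_XaY; set a := c * _.
  rewrite -mul_polyC rmorphM /= map_polyC /= map_polyXn comp_polyM comp_polyC.
  rewrite comp_Xn_poly exprDn mulr_sumr; apply: eq_bigr => i _.
  transitivity (m i (c * ('C(n, i)%:R * lam (isoclass P)))).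
    by rewrite /m /a [c * _ in RHS]mulrCA mulr_natl !polyCMn mulrnAl mulrnAr.
  have := lam_binomial K0 P setT i; rewrite sub_qp_setT -cl_isoclassT -/n => ->.
  rewrite mulr_sumr.
  rewrite (big_morph (m i) (mD i) (m0 i)); apply: eq_big => O.
    rewrite open_in_setT; apply: andb_id2l => oO.
    rewrite -val_eqE /= inordK cl_sub_qp // ltnS /n cl_isoclassT.
    by rewrite (ncl_open_in (oT _ oO)) leq_addr.
  by move=> /andP[_ /eqP <-]; rewrite cl_sub_qp setTD.
apply: eq_bigr => O oO; rewrite /m /tensor_poly /phi0_on.
have -> : (n - cl (sub_qp P O) = cl (sub_qp P (~: O)))%N.
  by rewrite /n cl_isoclassT (ncl_open_in (oT _ oO)) setTD !cl_sub_qp addKn.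
rewrite scalerA -!mul_polyC [(_ * 'X^_)^:P]rmorphM /= map_polyC map_polyXn /=.
by rewrite [(_%:P * _)%:P]polyCM polyC_exp mulrACA -!polyCM -[in RHS](mulrA c).
Qed.

Lemma phi0_hopf : hopf_morphism phi0.
Proof.
split=> x.
  rewrite /Delta tensor_map_linext; last 2 first.
  - by move=> b; rewrite /tensor_poly rmorph0 mul0r.
  - by move=> b a a'; rewrite /tensor_poly rmorphD mulrDl.
  have XYD : {morph @poly_XaY K : p q / p + q}.
    by move=> p q; rewrite /poly_XaY rmorphD comp_polyD.
  rewrite (linext_id phi0) /linext (big_morph _ XYD (poly_XaY0 _)).
  apply: eq_bigr => p _; rewrite /Delta_on tensor_map_scale_sum; last 2 first.
  - by move=> b; rewrite /tensor_poly rmorph0 mul0r.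
  - by move=> b a a'; rewrite /tensor_poly rmorphD mulrDl.
  rewrite phi0U -{1}[X in phi0_on X]repr_qpK phi0_on_coproduct.
  by apply: eq_bigr => O _; rewrite !phi0U.
rewrite (linext_id phi0) /linext horner_sum /counit_Delta.
rewrite [x in RHS]monalgE raddf_sum; apply: eq_bigr => p _ /=.
rewrite mcoeffU phi0U /phi0_on !hornerZ hornerXn expr0n cl_eq0.
by case: eqP => [->|_]; rewrite ?lam_empty ?mul1r ?mulr1 ?mulr0.
Qed.

Lemma phi0_homogeneous : homogeneous phi0.
Proof.
move=> n x xn; exists (\sum_(p <- msupp x) x@_p * lam p).
rewrite (linext_id phi0) /linext scaler_suml big_seq [RHS]big_seq.
by apply: eq_bigr => p /xn pn; rewrite phi0U /phi0_on pn scalerA.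
Qed.

Lemma lam_bullet n : (0 < n)%N -> lam (bullet n) = 1.
Proof.
move=> n0; rewrite /bullet -sub_qp_setT (lam_cl1 K0) // -cl_isoclassT.
exact: cl_bullet.
Qed.

Lemma phi0_bullet n : (0 < n)%N -> phi0 << bullet n >> = 'X.
Proof.
by move=> n0; rewrite phi0U /phi0_on lam_bullet // cl_bullet // scale1r.
Qed.

(** By homogeneity a linear term can only occur on a quasi-poset with a single
    class, which is one of the bullets. *)
Lemma homogeneous_coef1 (phi : {lrmorphism Hqp K -> {poly K}}) :
  homogeneous phi ->
  (forall n : nat, (0 < n)%N -> phi << bullet n >> = 'X) ->
  forall p, (phi << p >>)`_1 = (cl p == 1%N)%:R.
Proof.
move=> hom bul p; case: eqP => [/cl_eq1[n n0 ->]|/eqP p1].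
  by rewrite bul // coefX.
have [|c ->] := hom (cl p) << p >>.
  by move=> q; rewrite msuppU1 inE => /eqP ->.
by rewrite coefZ coefXn eq_sym (negbTE p1) mulr0.
Qed.

Lemma phi0_on_generator : has_generator (fun p => (cl p == 1%N)%:R) phi0_on.
Proof.
move=> A P; rewrite -phi0U (hopf_generator K0 phi0_hopf).
apply: eq_bigr => O _.
by rewrite (homogeneous_coef1 phi0_homogeneous phi0_bullet) phi0U.
Qed.

Lemma phi0_unique (psi : {lrmorphism Hqp K -> {poly K}}) :
  hopf_morphism psi -> homogeneous psi ->
  (forall n : nat, (0 < n)%N -> psi << bullet n >> = 'X) ->
  psi =1 phi0.
Proof.
move=> hopf hom bul x; rewrite (linext_id psi) (linext_id phi0).
apply: eq_linext; apply: (has_generator_inj K0 (f := fun p => (cl p == 1%N)%:R)).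
- by rewrite cl_empty.
- move=> A P; rewrite (hopf_generator K0 hopf).
  by apply: eq_bigr => O _; rewrite (homogeneous_coef1 hom bul).
- move=> A P; rewrite phi0U phi0_on_generator.
  by apply: eq_bigr => O _; rewrite phi0U.
- by move=> p; rewrite hopf.2 phi0_hopf.2.
Qed.

End Phi0.

(** * Counting monotone maps *)

Section Monotone.
Variable b : bool.

Section Maps.
Variables (A : finType) (P : qposet A).

(** The ordinary monotone maps for [b = true] and the strict ones for
    [b = false]. *)
Definition mono_maps k : {set {ffun A -> 'I_k}} :=
  [set f : {ffun A -> 'I_k} | [forall i, forall j, le_qp P i j ==>
     (f i < f j)%N || (f i == f j) && (b || le_qp P j i)]].

Lemma mono_mapsP k (f : {ffun A -> 'I_k}) :
  reflect (forall i j, le_qp P i j ->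
             (f i < f j)%N || (f i == f j) && (b || le_qp P j i))
          (f \in mono_maps k).
Proof.
rewrite inE; apply: (iffP forallP) => [h i j ij|h i].
  by have /forallP/(_ j) := h i; rewrite ij.
by apply/forallP=> j; apply/implyP; apply: h.
Qed.

End Maps.

Lemma card_mono_sum (A B : finType) (P : qposet A) (Q : qposet B) k :
  #|mono_maps (sum_qp P Q) k| = (#|mono_maps P k| * #|mono_maps Q k|)%N.
Proof.
pose F (f : {ffun A + B -> 'I_k}) : {ffun A -> 'I_k} * {ffun B -> 'I_k} :=
  ([ffun x => f (inl x)], [ffun y => f (inr y)]).
have FI : injective F.
  move=> f g [/ffunP fgA /ffunP fgB]; apply/ffunP=> -[x|x].
    by have := fgA x; rewrite !ffunE.
  by have := fgB x; rewrite !ffunE.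
rewrite -cardsX -(card_imset _ FI); congr #|pred_of_set _|.
apply/setP=> -[g h]; rewrite in_setX /=; apply/imsetP/andP.
  case=> f /mono_mapsP fm [-> ->]; split; apply/mono_mapsP=> i j ij;
    rewrite !ffunE.
    by have := fm (inl i) (inl j); rewrite !mk_qposetE /=; apply.
  by have := fm (inr i) (inr j); rewrite !mk_qposetE /=; apply.
case=> /mono_mapsP gm /mono_mapsP hm.
exists [ffun u => match u with inl x => g x | inr y => h y end]; last first.
  by congr (_, _); apply/ffunP=> x; rewrite !ffunE.
apply/mono_mapsP=> -[i|i] [j|j]; rewrite !mk_qposetE //= !ffunE.
  exact: gm.
exact: hm.
Qed.

Section Split.
Variables (A : finType) (P : qposet A) (k l : nat).

Section Glue.
Variables (O : {set A}).
Hypothesis oO : open_qp P O.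

Let mem_compl x : x \notin O -> x \in ~: O. Proof. by rewrite inE. Qed.

Let split_ex x : exists u, @split_val A O u == x.
Proof. by have [u <-] := split_val_surj O x; exists u. Qed.

Let glue (u : {ffun {x | x \in ~: O} -> 'I_k} * {ffun {x | x \in O} -> 'I_l}) :
    {ffun A -> 'I_(k + l)} :=
  [ffun x => match xchoose (split_ex x) with
             | inl y => rshift k (u.2 y)
             | inr y => lshift l (u.1 y)
             end].

Let choose_split v : xchoose (split_ex (split_val v)) = v.
Proof. exact/split_val_inj/eqP/(xchooseP (split_ex (split_val v))). Qed.

Let glueO u x : glue u (val x) = rshift k (u.2 x).
Proof. by rewrite ffunE (choose_split (inl x)). Qed.

Let glueC u x : glue u (val x) = lshift l (u.1 x).
Proof. by rewrite ffunE (choose_split (inr x)). Qed.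

Let glue_inj : injective glue.
Proof.
move=> [g h] [g' h'] /ffunP E; congr (_, _); apply/ffunP=> x.
  by have := E (val x); rewrite !glueC => /lshift_inj.
by have := E (val x); rewrite !glueO => /rshift_inj.
Qed.

(** A monotone map whose values from [k] on are taken exactly on [O] is a pair
    of monotone maps, on [O] and on its complement. Between the two parts the
    inequality is strict, so that no condition links them, strict or not. *)
Lemma card_mono_threshold :
  #|[set f in mono_maps P (k + l) | [set x | (k <= f x)%N] == O]| =
  (#|mono_maps (restr_qp P (~: O)) k| * #|mono_maps (restr_qp P O) l|)%N.
Proof.
rewrite -cardsX -(card_imset _ glue_inj); congr #|pred_of_set _|.
apply/setP=> f; apply/idP/imsetP => [|[[g h]]]; last first.
  rewrite in_setX /= => /andP[/mono_mapsP gm /mono_mapsP hm] ->.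
  rewrite inE; apply/andP; split; last first.
    apply/eqP/setP=> x; rewrite inE; have [xO|xO] := boolP (x \in O).
      by have [u ->] := sub_ex xO; rewrite glueO leq_addr.
    have [u ->] := sub_ex (mem_compl xO); rewrite glueC /= leqNgt ltn_ord.
    by [].
  apply/mono_mapsP=> i j ij; have [iO|iO] := boolP (i \in O).
    have jO : j \in O by move/open_qpP: oO => /(_ i j iO ij).
    move: ij; have [u ->] := sub_ex iO; have [v ->] := sub_ex jO.
    rewrite -!le_restr !glueO /= ltn_add2l (inj_eq (@rshift_inj _ _)) => uv.
    exact: hm.
  have [jO|jO] := boolP (j \in O).
    have [u ->] := sub_ex (mem_compl iO); have [v ->] := sub_ex jO.
    by rewrite glueC glueO /= ltn_addr.
  move: ij; have [u ->] := sub_ex (mem_compl iO).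
  have [v ->] := sub_ex (mem_compl jO).
  rewrite -!le_restr !glueC /= (inj_eq (@lshift_inj _ _)) => uv.
  exact: gm.
rewrite inE => /andP[/mono_mapsP fm /eqP/setP fO].
have fge (u : {x | x \in O}) : (f (val u) - k < l)%N.
  have : (k <= f (val u))%N by have := fO (val u); rewrite inE (valP u).
  by move=> kf; rewrite ltn_subLR.
have flt (u : {x | x \in ~: O}) : (f (val u) < k)%N.
  rewrite ltnNge; have := fO (val u); rewrite inE => ->.
  by have : val u \in ~: O := valP u; rewrite inE.
pose g := [ffun u => Ordinal (flt u)]; pose h := [ffun u => Ordinal (fge u)].
have fE : f = glue (g, h).
  apply/ffunP=> x; have [xO|xO] := boolP (x \in O).
    have [u ->] := sub_ex xO; rewrite glueO /= ffunE; apply: val_inj => /=.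
    by rewrite subnKC //; have := fO (val u); rewrite inE (valP u).
  by have [u ->] := sub_ex (mem_compl xO); rewrite glueC ffunE; apply: val_inj.
exists (g, h) => //; rewrite in_setX /=; apply/andP; split; apply/mono_mapsP=> u v.
  rewrite le_restr => /fm; rewrite fE !glueC /= (inj_eq (@lshift_inj _ _)).
  by rewrite le_restr.
rewrite le_restr => /fm; rewrite fE !glueO /= ltn_add2l (inj_eq (@rshift_inj _ _)).
by rewrite le_restr.
Qed.

End Glue.

(** The points where a monotone map is at least [k] form an open set. *)
Lemma card_mono_split :
  #|mono_maps P (k + l)| =
  (\sum_(O | open_qp P O)
     #|mono_maps (restr_qp P (~: O)) k| * #|mono_maps (restr_qp P O) l|)%N.
Proof.
rewrite -sum1_card.
rewrite (partition_big (fun f : {ffun A -> 'I_(k + l)} => [set x | (k <= f x)%N])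
   (open_qp P)) /=; last first.
  move=> f /mono_mapsP fm; apply/open_qpP=> i j; rewrite !inE => ki /fm.
  by case/orP=> [/ltnW|/andP[/eqP <- //]]; apply: leq_trans.
apply: eq_bigr => O oO; rewrite -card_mono_threshold // -sum1_card.
by apply: eq_bigl => f; rewrite [in RHS]inE.
Qed.

End Split.
End Monotone.

Lemma L_mapsE (A : finType) (P : qposet A) k : L_maps P k = mono_maps true P k.
Proof.
apply/setP=> f; rewrite !inE; apply: eq_forallb => i; apply: eq_forallb => j.
by rewrite andbT leq_eqVlt orbC.
Qed.

Lemma Lstr_mapsE (A : finType) (P : qposet A) k :
  Lstr_maps P k = mono_maps false P k.
Proof.
apply/setP=> f; rewrite inE L_mapsE; apply/andP/mono_mapsP.
  move=> [/mono_mapsP fm /forallP fs] i j ij.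
  case/orP: (fm i j ij) => [-> //|/andP[fij _]].
  have /forallP/(_ j) := fs i; rewrite ij fij /= => /andP[_ ->].
  by rewrite orbT.
move=> fm; split.
  apply/mono_mapsP=> i j /fm; case/orP=> [-> //|/andP[-> _]].
  by rewrite orbT.
apply/forallP=> i; apply/forallP=> j; apply/implyP=> /andP[ij /eqP fij].
by have := fm i j ij; rewrite fij ltnn eqxx /= => ji; apply/andP.
Qed.

Section Counting.
Variables (K : fieldType) (K0 : [pchar K] =i pred0) (b : bool).
Variable F : qp -> {poly K}.
Hypothesis FE : forall (A : finType) (P : qposet A) k, (0 < k)%N ->
  (F (isoclass P)).[k%:R] = #|mono_maps b P k|%:R.

Lemma count_union p q : F (union_qp p q) = F p * F q.
Proof.
apply: (poly_eq_nat K0) => k k0; rewrite -[p]repr_qpK -[q]repr_qpK.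
by rewrite union_isoclass hornerM !FE // card_mono_sum natrM.
Qed.

Lemma count_shift (A : finType) (P : qposet A) k : (0 < k)%N ->
  F (isoclass P) \Po (k%:R%:P + 'X) =
  \sum_(O | open_qp P O) (F (sub_qp P (~: O))).[k%:R] *: F (sub_qp P O).
Proof.
move=> k0; apply: (poly_eq_nat K0) => l l0.
rewrite horner_comp horner_sum hornerD hornerC hornerX -natrD.
rewrite FE ?addn_gt0 ?k0 // card_mono_split natr_sum.
by apply: eq_bigr => O _; rewrite hornerZ !FE // natrM.
Qed.

Lemma count_generator : has_generator (fun p => (F p)`_1) F.
Proof. exact/(has_generator_shift K0)/count_shift. Qed.

Lemma count_empty : F empty_qp = 1.
Proof.
apply: (poly_eq_nat K0) => k k0; rewrite FE // hornerC.
rewrite (_ : mono_maps _ _ _ = setT); last first.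
  by apply/setP=> f; rewrite in_setT; apply/mono_mapsP=> -[].
by rewrite cardsT card_ffun !card_ord expn0.
Qed.

(** Put [X = 0] in the shift formula for [k = 1]. By induction only the empty
    open set and the full one contribute; the former contributes the left-hand
    side, so that the latter, which is the value at 0, vanishes. *)
Lemma count_horner0 p : (F p).[0] = (p == empty_qp)%:R.
Proof.
case: eqP => [->|/eqP]; first by rewrite count_empty hornerC.
rewrite -[p]repr_qpK.
suff H n (A : finType) (P : qposet A) : (#|A| < n)%N ->
   isoclass P != empty_qp -> (F (isoclass P)).[0] = 0 by exact: H (ltnSn _).
elim: n A P => // n IH A P /ltnSE leA P0.
have A0 : [set: A] != set0.
  by apply: contra P0 => /eqP E; rewrite -sub_qp_setT E sub_qp0.
have /(congr1 (fun q => q.[0])) := count_shift P (ltn0Sn 0).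
rewrite horner_comp hornerD hornerC hornerX addr0 horner_sum.
rewrite (bigD1 set0) /=; last by apply/open_qpP=> i j; rewrite inE.
rewrite (bigD1 setT) /=; last by rewrite A0 andbT; apply/open_qpP.
rewrite setC0 setCT !sub_qp_setT !sub_qp0 !hornerZ !count_empty !hornerC.
rewrite mul1r mulr1.
rewrite big1 ?addr0 => [|O /andP[/andP[_ O0] OT]].
  by rewrite -[LHS]addr0 => /addrI.
rewrite hornerZ IH ?mulr0 //.
  rewrite card_subset_type; apply: leq_trans leA.
  by rewrite -cardsT; apply: proper_card; rewrite properT.
by rewrite -cl_eq0 cl_sub_qp ncl_eq0.
Qed.

End Counting.

(** * Products over connected components *)

Section Components.
Variables (A : finType) (P : qposet A).
Implicit Types (B O : {set A}).

Lemma open_qpI U V : open_qp P U -> open_qp P V -> open_qp P (U :&: V).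
Proof.
move=> /open_qpP oU /open_qpP oV; apply/open_qpP=> i j; rewrite !inE.
by move=> /andP[iU iV] ij; rewrite (oU i j) // (oV i j).
Qed.

Lemma open_qpU U V : open_qp P U -> open_qp P V -> open_qp P (U :|: V).
Proof.
move=> /open_qpP oU /open_qpP oV; apply/open_qpP=> i j; rewrite !inE.
by move=> /orP[iU|iV] ij; apply/orP; [left; apply: oU ij | right; apply: oV ij].
Qed.

Lemma connected_sub_qp (C : finType) (Q : qposet C) B (B' : {set C}) :
  sub_qp P B = sub_qp Q B' ->
  connected_qp (restr_qp P B) = connected_qp (restr_qp Q B').
Proof. by move=> /isoclassP/connected_iso. Qed.

Definition component B :=
  [&& B != set0, clopen P B & connected_qp (restr_qp P B)].

(** The trace of a clopen set on a connected subset is clopen. *)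
Lemma connected_sub_clopen B O :
  connected_qp (restr_qp P B) -> clopen P O ->
  (B \subset O) || (B \subset ~: O).
Proof.
move=> /forallP/(_ (subpre B O))/implyP cB /andP[/open_qpP oO /open_qpP oC].
have /cB/orP[] : open_qp (restr_qp P B) (subpre B O) &&
    open_qp (restr_qp P B) (~: subpre B O).
  apply/andP; split; apply/open_qpP=> u v; rewrite !inE le_restr.
    exact: oO.
  by move=> uC uv; have := oC _ _ _ uv; rewrite !inE; apply.
- move=> /eqP/setP E; apply/orP; right; apply/subsetP=> x xB.
  by have := E (Sub x xB); rewrite !inE => ->.
- move=> /eqP/setP E; apply/orP; left; apply/subsetP=> x xB.
  by have := E (Sub x xB); rewrite !inE => ->.
Qed.

Lemma clopen_restr O B : clopen P O -> B \subset O ->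
  clopen (restr_qp P O) (subpre O B) = clopen P B.
Proof.
move=> /andP[oO oC] BO.
have E (C : {set A}) : C \subset O ->
    open_qp (restr_qp P O) (subpre O C) = open_qp P C.
  move=> CO; have := open_in_sub (U := O) C (B := setT) (P := P).
  by rewrite !open_in_setT /open_in CO andbT; apply.
rewrite /clopen E //; congr andb.
have -> : ~: subpre O B = subpre O (O :\: B).
  by apply/setP=> u; rewrite !inE (valP u) andbT.
rewrite E ?subsetDl //; apply/idP/idP => h.
  have -> : ~: B = (O :\: B) :|: ~: O.
    by rewrite setDE setUIl setUCr setTI -setCI (setIidPl BO).
  exact: open_qpU.
by rewrite setDE; apply: open_qpI.
Qed.

Lemma component_restr O B : clopen P O -> B \subset O ->
  component B =
  [&& subpre O B != set0, clopen (restr_qp P O) (subpre O B) &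
      connected_qp (restr_qp (restr_qp P O) (subpre O B))].
Proof.
move=> cO BO; rewrite clopen_restr // /component.
rewrite (connected_sub_qp (esym (sub_qp_subpre _ BO))); congr andb.
have -> : (B == set0) = (subpre O B == set0) => //.
rewrite -{1}(subpreK BO) imset_eq0 //.
Qed.

End Components.

Lemma preimset_bij (A B : finType) (f : A -> B) (g : B -> A) :
  cancel f g -> cancel g f -> bijective (fun O : {set B} => f @^-1: O).
Proof.
move=> fK gK; exists (fun O : {set A} => g @^-1: O) => O; apply/setP=> x.
  by rewrite !inE gK.
by rewrite !inE fK.
Qed.

Section ComponentProduct.
Variables (R : comNzRingType) (a : qp -> R).

Definition comp_prod_on (A : finType) (P : qposet A) : R :=
  \prod_(B | component P B) a (sub_qp P B).

Definition comp_prod (p : qp) : R := comp_prod_on (repr_qp p).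

Lemma comp_prod_isoclass (A : finType) (P : qposet A) :
  comp_prod (isoclass P) = comp_prod_on P.
Proof.
have /iso_qpP[f [g fK gK] fP] := iso_repr_qp P.
have preim_bij := preimset_bij fK gK.
rewrite /comp_prod /comp_prod_on (reindex _ (onW_bij _ preim_bij)) /=.
have sub_qpE (B : {set A}) :
    sub_qp (repr_qp (isoclass P)) (f @^-1: B) = sub_qp P B.
  exact/isoclassP/(restr_inv fK gK fP).
apply: eq_big => B; last by rewrite sub_qpE.
rewrite /component /clopen -preimsetC !(open_inv gK fP).
rewrite (connected_sub_qp (sub_qpE B)).
by rewrite -(inj_eq (bij_inj preim_bij) B) preimset0.
Qed.

(** The components of a clopen set are the components that it contains. *)
Lemma comp_prod_half (A : finType) (P : qposet A) (O : {set A}) : clopen P O ->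
  comp_prod (sub_qp P O) =
  \prod_(B | component P B && (B \subset O)) a (sub_qp P B).
Proof.
move=> cO; rewrite comp_prod_isoclass /comp_prod_on.
rewrite (reindex_onto (subpre O) (fun S => val @: S)) /=; last first.
  by move=> S _; rewrite imset_valK.
have EB (B : {set A}) : ([set val u | u in subpre O B] == B) = (B \subset O).
  apply/eqP/idP => [<-|/subpreK //].
  by apply/subsetP=> _ /imsetP[u _ ->]; apply: valP.
apply: eq_big => B; rewrite EB; last by move=> /andP[_ BO]; rewrite sub_qp_subpre.
by apply: andb_id2r => BO; rewrite (component_restr cO BO).
Qed.

(** Each component lies on one side of a clopen set. *)
Lemma comp_prod_clopen (A : finType) (P : qposet A) (O : {set A}) : clopen P O ->
  comp_prod (isoclass P) = comp_prod (sub_qp P O) * comp_prod (sub_qp P (~: O)).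
Proof.
move=> cO; have cC : clopen P (~: O) by rewrite /clopen setCK andbC.
rewrite (comp_prod_isoclass P) (comp_prod_half cO) (comp_prod_half cC).
rewrite /comp_prod_on.
rewrite (bigID (fun B : {set A} => B \subset O)) /=; congr (_ * _).
apply: eq_bigl => B; apply: andb_id2l => /and3P[/set0Pn[x xB] _ cB].
have := connected_sub_clopen cB cO; case: (boolP (B \subset O)) => //= BO _.
apply/esym/negbTE/subsetPn; exists x => //.
by rewrite inE (subsetP BO).
Qed.

Lemma comp_prod_connected (A : finType) (P : qposet A) :
  (0 < #|A|)%N -> connected_qp P -> comp_prod (isoclass P) = a (isoclass P).
Proof.
move=> A0 cP; rewrite comp_prod_isoclass /comp_prod_on -(sub_qp_setT P).
have T0 : [set: A] != set0 by rewrite -cards_eq0 cardsT -lt0n.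
apply: big_pred1 => B; apply/and3P/eqP => [[B0 cB _]|->].
  by have /forallP/(_ B)/implyP/(_ cB) := cP; rewrite (negbTE B0) => /eqP.
split=> //; first by apply/andP; split; apply/open_qpP => i j; rewrite !inE.
by rewrite (connected_iso (Q := P)) //; apply/isoclassP; apply: sub_qp_setT.
Qed.

Lemma comp_prod_empty : comp_prod empty_qp = 1.
Proof.
rewrite comp_prod_isoclass /comp_prod_on big1 // => B /and3P[/set0Pn[[]]//].
Qed.

Lemma comp_prod_union p q : comp_prod (union_qp p q) = comp_prod p * comp_prod q.
Proof. by move: p q; apply: union_mult => A P O; apply: comp_prod_clopen. Qed.

End ComponentProduct.

Lemma disconnected_clopen (A : finType) (P : qposet A) : ~~ connected_qp P ->
  exists O, [/\ clopen P O, O != set0 & ~: O != set0].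
Proof.
rewrite negb_forall => /existsP[O]; rewrite negb_imply negb_or => /and3P[cO O0 OT].
by exists O; split=> //; rewrite -setCT (inj_eq (can_inj (@setCK _))).
Qed.

(** Every quasi-poset is a disjoint union of connected ones. *)
Lemma eq_mult (T : pzSemiRingType) (h h' : qp -> T) :
  (forall p q, h (union_qp p q) = h p * h q) ->
  (forall p q, h' (union_qp p q) = h' p * h' q) ->
  h empty_qp = h' empty_qp ->
  (forall (A : finType) (P : qposet A), (0 < #|A|)%N -> connected_qp P ->
     h (isoclass P) = h' (isoclass P)) ->
  h =1 h'.
Proof.
move=> hM hM' h0 hc p; rewrite -[p]repr_qpK.
suff H n (A : finType) (P : qposet A) : (#|A| < n)%N ->
   h (isoclass P) = h' (isoclass P) by exact: H (ltnSn _).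
elim: n A P => // n IH A P /ltnSE leA.
have [A0|A0] := posnP #|A|; first by rewrite (qp_of_card0 _ A0).
have [cP|/disconnected_clopen[O [cO O0 C0]]] := boolP (connected_qp P).
  exact: hc.
have lt (B : {set A}) : ~: B != set0 -> (#|{: {x | x \in B}}| < n)%N.
  move=> B0; apply: leq_trans leA; rewrite card_subset_type.
  rewrite -cardsT; apply: proper_card; rewrite properT.
  by apply: contra B0 => /eqP ->; rewrite setCT.
by rewrite (union_clopen cO) hM hM' !IH ?lt ?setCK.
Qed.

(** * Contractions with a marked maximal class *)

Section Equivalences.
Variable A : finType.

Lemma eqv_sym (E : equivalence A) x y : le_qp E x y = le_qp E y x.
Proof.
have h u v : le_qp E u v -> le_qp E v u.
  by have /forallP/(_ u)/forallP/(_ v)/implyP := valP E.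
by apply/idP/idP; apply: h.
Qed.

Lemma eqv_ext (E E' : equivalence A) : le_qp E =2 le_qp E' -> E = E'.
Proof.
by move=> h; do 2!apply/val_inj; apply/ffunP=> -[x y]; apply: h.
Qed.

Lemma mk_eqv_subproof (r : rel A) (rr : reflexive r) (tr : transitive r) :
  symmetric r -> sym_qp (mk_qposet rr tr).
Proof.
move=> rs; apply/forallP=> x; apply/forallP=> y; rewrite !mk_qposetE rs.
exact: implybb.
Qed.

Definition mk_eqv (r : rel A) (rr : reflexive r) (tr : transitive r)
  (rs : symmetric r) : equivalence A := Equivalence (mk_eqv_subproof rr tr rs).

Lemma mk_eqvE r rr tr rs : le_qp (@mk_eqv r rr tr rs) =2 r.
Proof. exact: mk_qposetE. Qed.

Definition total_eqv : equivalence A :=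
  mk_eqv (r := fun _ _ => true) (fun _ => isT) (@true_trans A) (fun _ _ => erefl).

Variable P : qposet A.

Lemma admissibleP (E : equivalence A) :
  reflect ((forall x, connected_qp (restr_qp P [set y | le_qp E x y])) /\
           (forall x y, sim_qp (contract_equiv P E) x y = le_qp E x y))
          (admissible P E).
Proof.
apply: (iffP andP) => [[/forallP c /forallP s]|[c s]].
  by split=> // x y; have /forallP/(_ y)/eqP := s x.
by split; apply/forallP=> x //; apply/forallP=> y; rewrite s.
Qed.

Lemma le_contract (E : equivalence A) x y :
  le_qp P x y -> le_qp (contract_equiv P E) x y.
Proof. by move=> xy; rewrite mk_qposetE; apply: connect1; rewrite xy. Qed.

Lemma le_contract_eqv (E : equivalence A) x y :
  le_qp E x y -> le_qp (contract_equiv P E) x y.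
Proof. by move=> xy; rewrite mk_qposetE; apply: connect1; rewrite xy orbT. Qed.

Lemma total_admissible : connected_qp P -> admissible P total_eqv.
Proof.
move=> cP; apply/admissibleP; split=> [x|x y].
  rewrite (connected_iso (Q := P)) //; apply/isoclassP; rewrite -[RHS]sub_qp_setT.
  by congr sub_qp; apply/setP=> y; rewrite !inE mk_eqvE.
by rewrite mk_eqvE /sim_qp !le_contract_eqv // mk_eqvE.
Qed.

End Equivalences.

Section Extension.
Variables (A : finType) (P : qposet A) (O : {set A}).
Local Notation T := {x | x \in ~: O}.

Lemma restr_eqv_sym (E : equivalence A) :
  symmetric (fun u v : T => le_qp E (val u) (val v)).
Proof. by move=> u v; apply: eqv_sym. Qed.

Definition restr_eqv (E : equivalence A) : equivalence T :=
  mk_eqv (pull_refl val E) (@pull_trans _ _ val E) (restr_eqv_sym E).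

Section Ext.
Variable E' : equivalence T.

(** The points where [insub] fails are those of [O], which thus becomes one
    more class. *)
Definition ext_rel : rel A := fun x y =>
  match insub x : option T, insub y : option T with
  | Some u, Some v => le_qp E' u v
  | None, None => true
  | _, _ => false
  end.

Lemma ext_rel_refl : reflexive ext_rel.
Proof. by move=> x; rewrite /ext_rel; case: insub => // u; apply: le_qp_refl. Qed.

Lemma ext_rel_trans : transitive ext_rel.
Proof.
move=> y x z; rewrite /ext_rel.
by case: insub => [u|]; case: insub => [v|] //; case: insub => // w;
  apply: le_qp_trans.
Qed.

Lemma ext_rel_sym : symmetric ext_rel.
Proof.
move=> x y; rewrite /ext_rel.
by case: insub => [u|]; case: insub => [v|] //; apply: eqv_sym.
Qed.

Definition ext_eqv : equivalence A :=
  mk_eqv ext_rel_refl ext_rel_trans ext_rel_sym.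

Lemma ext_eqv_val (u v : T) : le_qp ext_eqv (val u) (val v) = le_qp E' u v.
Proof. by rewrite mk_eqvE /ext_rel !valK. Qed.

Lemma ext_eqv_O x y : x \in O -> le_qp ext_eqv x y = (y \in O).
Proof.
move=> xO; rewrite mk_eqvE /ext_rel insubF ?inE ?xO //.
case: insubP => [u|]; rewrite inE; first by move=> /negbTE ->.
by move/negbNE ->.
Qed.

Lemma restr_extK : restr_eqv ext_eqv = E'.
Proof. by apply: eqv_ext => u v; rewrite mk_eqvE ext_eqv_val. Qed.

End Ext.

Lemma ext_restrK (E : equivalence A) :
  (forall x y, x \in O -> le_qp E x y = (y \in O)) -> ext_eqv (restr_eqv E) = E.
Proof.
move=> EO; apply: eqv_ext => x y.
have [xO|xO] := boolP (x \in O); first by rewrite ext_eqv_O // EO.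
have [yO|yO] := boolP (y \in O).
  by rewrite eqv_sym [RHS]eqv_sym ext_eqv_O // EO.
have /sub_ex[u ->] : x \in ~: O by rewrite inE.
have /sub_ex[v ->] : y \in ~: O by rewrite inE.
by rewrite ext_eqv_val mk_eqvE.
Qed.

Section OpenClass.
Hypothesis oO : open_qp P O.
Variable E' : equivalence T.
Local Notation E := (ext_eqv E').
Local Notation P' := (restr_qp P (~: O)).

Lemma open_contract_ext : open_qp (contract_equiv P E) O.
Proof.
apply/open_qpP=> x y xO; rewrite mk_qposetE => /connectP[p + ->].
elim: p x xO => //= z p IH x xO /andP[xz]; apply: IH.
case/orP: xz => [|]; first by move/open_qpP: oO; apply.
by rewrite ext_eqv_O.
Qed.

(** A path that enters the open set [O] stays there, so a path between two
    points outside [O] never meets it. *)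
Lemma contract_ext_val u v :
  le_qp (contract_equiv P E) (val u) (val v) = le_qp (contract_equiv P' E') u v.
Proof.
apply/idP/idP; last first.
  rewrite !mk_qposetE; apply: connect_homo => {}u {}v.
  by rewrite le_restr ext_eqv_val.
rewrite [in X in X -> _]mk_qposetE => /connectP[p].
elim: p u => /= [u _ /val_inj ->|z p IH u]; first exact: le_qp_refl.
move=> /andP[uz zp] vE.
have zv : le_qp (contract_equiv P E) z (val v).
  by rewrite mk_qposetE; apply/connectP; exists p.
have : z \in ~: O.
  rewrite inE; apply/negP=> zO.
  have /open_qpP/(_ _ _ zO zv) := open_contract_ext.
  by have : val v \in ~: O := valP v; rewrite inE => /negbTE ->.
move=> /sub_ex[w zE]; rewrite zE in uz zp vE.
apply: le_qp_trans (IH w zp vE); rewrite mk_qposetE; apply: connect1.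
by rewrite le_restr -ext_eqv_val.
Qed.

Lemma sub_qp_contract_ext :
  sub_qp (contract_equiv P E) (~: O) = isoclass (contract_equiv P' E').
Proof.
apply/isoclassP/iso_qpP; exists id; first by exists id.
by move=> u v; rewrite le_restr contract_ext_val.
Qed.

Lemma clopen_restr_ext : clopen (restr_equiv P E) O.
Proof.
apply/andP; split; apply/open_qpP=> x y; rewrite mk_qposetE.
  by move=> xO /andP[_]; rewrite ext_eqv_O.
rewrite !inE => xO /andP[_]; rewrite eqv_sym; apply: contraL => yO.
by rewrite ext_eqv_O.
Qed.

Lemma sub_qp_restr_ext_O : sub_qp (restr_equiv P E) O = sub_qp P O.
Proof.
apply/isoclassP/iso_qpP; exists id; first by exists id.
by move=> u v; rewrite !le_restr mk_qposetE ext_eqv_O ?(valP v) ?(valP u) ?andbT.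
Qed.

Lemma sub_qp_restr_ext_C :
  sub_qp (restr_equiv P E) (~: O) = isoclass (restr_equiv P' E').
Proof.
apply/isoclassP/iso_qpP; exists id; first by exists id.
by move=> u v; rewrite le_restr mk_qposetE [RHS]mk_qposetE ext_eqv_val le_restr.
Qed.

(** The new class [O] only adds the condition that it be connected: as it is
    open, it is not merged with any other class in the contraction. *)
Lemma admissible_ext : O != set0 ->
  admissible P E = connected_qp (restr_qp P O) && admissible P' E'.
Proof.
move=> /set0Pn[x0 x0O].
have clO x : x \in O -> [set y | le_qp E x y] = O.
  by move=> xO; apply/setP=> y; rewrite inE ext_eqv_O.
have clC (u : T) : connected_qp (restr_qp P [set y | le_qp E (val u) y]) =
                   connected_qp (restr_qp P' [set v | le_qp E' u v]).
  apply: connected_sub_qp; rewrite sub_qp_sub_qp; congr sub_qp.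
  apply/setP=> y; rewrite inE.
  apply/idP/imsetP => [uy|[v + ->]]; last by rewrite inE ext_eqv_val.
  have : y \in ~: O.
    rewrite inE; apply: contraL uy => yO; rewrite eqv_sym ext_eqv_O //.
    by have := valP u; rewrite inE.
  by move=> /sub_ex[v yE]; exists v; rewrite // inE -ext_eqv_val -yE.
have simE u v : sim_qp (contract_equiv P E) (val u) (val v) =
                sim_qp (contract_equiv P' E') u v.
  by rewrite /sim_qp !contract_ext_val.
apply/admissibleP/andP => [[c s]|[cO /admissibleP[c s]]].
  split; first by have := c x0; rewrite clO.
  apply/admissibleP; split=> [u|u v]; first by rewrite -clC.
  by rewrite -simE s ext_eqv_val.
split=> [x|x y].
  have [xO|xO] := boolP (x \in O); first by rewrite clO.
  have /sub_ex[u ->] : x \in ~: O by rewrite inE.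
  by rewrite clC.
have mixed z t : z \in O -> sim_qp (contract_equiv P E) z t = (t \in O).
  move=> zO; apply/andP/idP => [[zt _]|tO].
    by have /open_qpP/(_ _ _ zO zt) := open_contract_ext.
  by rewrite !le_contract_eqv // ext_eqv_O.
have [xO|xO] := boolP (x \in O); first by rewrite mixed // ext_eqv_O.
have [yO|yO] := boolP (y \in O).
  by rewrite sim_sym eqv_sym mixed // ext_eqv_O.
have /sub_ex[u ->] : x \in ~: O by rewrite inE.
have /sub_ex[v ->] : y \in ~: O by rewrite inE.
by rewrite simE s ext_eqv_val.
Qed.

End OpenClass.

Definition max_class (E : equivalence A) :=
  open_qp (contract_equiv P E) O && (cl (sub_qp (contract_equiv P E) O) == 1%N).

(** Admissibility says that the classes of the contraction are those of [E]. *)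
Lemma max_class_eqv (E : equivalence A) : admissible P E -> max_class E ->
  forall x y, x \in O -> le_qp E x y = (y \in O).
Proof.
move=> /admissibleP[_ s] /andP[/open_qpP oO]; rewrite cl_sub_qp.
move=> /ncl_eq1P[_ h] x y xO.
rewrite -s; apply/idP/idP => [/andP[xy _]|yO]; first exact: oO xy.
exact: h.
Qed.

Lemma admissible_max_class (E' : equivalence T) :
  admissible P (ext_eqv E') && max_class (ext_eqv E') =
  [&& open_qp P O, O != set0, connected_qp (restr_qp P O) &
      admissible (restr_qp P (~: O)) E'].
Proof.
have [oO|oO] /= := boolP (open_qp P O); last first.
  apply/negP=> /andP[_ /andP[/open_qpP h _]]; case/open_qpP: oO => i j iO ij.
  exact/(h i)/le_contract.
have [O0|O0] /= := boolP (O == set0).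
  have cO (Q : qposet A) : (cl (sub_qp Q O) == 1%N) = false.
    by rewrite cl_sub_qp (eqP O0) ncl0.
  by rewrite /max_class cO !andbF.
rewrite admissible_ext // /max_class open_contract_ext //=.
suff -> : cl (sub_qp (contract_equiv P (ext_eqv E')) O) == 1%N by rewrite andbT.
rewrite cl_sub_qp; apply/ncl_eq1P; split=> // x y xO yO.
by rewrite /sim_qp !le_contract_eqv // ext_eqv_O.
Qed.

(** Removing a marked maximal class [O] of the contraction from [E] loses
    nothing: [E] is recovered by adding back [O] as a class. *)
Lemma sum_max_class (V : nmodType) (G : qp -> qp -> V) :
  \sum_(E | admissible P E && max_class E)
     G (sub_qp (contract_equiv P E) (~: O)) (isoclass (restr_equiv P E)) =
  if [&& open_qp P O, O != set0 & connected_qp (restr_qp P O)] then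
    \sum_(E' | admissible (restr_qp P (~: O)) E')
       G (isoclass (contract_equiv (restr_qp P (~: O)) E'))
         (union_qp (sub_qp P O) (isoclass (restr_equiv (restr_qp P (~: O)) E')))
  else 0.
Proof.
rewrite (reindex_onto ext_eqv restr_eqv) /=; last first.
  by move=> E /andP[aE mE]; apply/ext_restrK/max_class_eqv.
case: ifP => [/and3P[oO O0 cO]|nO]; last first.
  apply: big_pred0 => E'; rewrite admissible_max_class.
  by apply: contraFF nO => /andP[/and4P[-> -> ->]].
apply: eq_big => E'.
  by rewrite restr_extK eqxx andbT admissible_max_class oO O0 cO.
move=> _; rewrite sub_qp_contract_ext // (union_clopen (clopen_restr_ext _)).
by rewrite sub_qp_restr_ext_O sub_qp_restr_ext_C.
Qed.

End Extension.

(** * The action of characters on the homogeneous morphism *)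

Section Action.
Variables (K : fieldType) (K0 : [pchar K] =i pred0).

Local Notation phi0 := (phi0 K0).
Local Notation phi0_on := (phi0_on K).

Lemma act_phi0_linext (chi : character K) (x : Hqp K) :
  act phi0 chi x = linext (fun p =>
    \sum_(E | admissible (repr_qp p) E)
       (chi << isoclass (restr_equiv (repr_qp p) E) >> : K) *:
         phi0_on (isoclass (contract_equiv (repr_qp p) E))) x.
Proof.
rewrite /act /delta tensor_map_linext; last 2 first.
- by move=> c; rewrite scaler0.
- by move=> c p q; rewrite scalerDr.
apply: eq_bigr => p _; rewrite /delta_on tensor_map_scale_sum; last 2 first.
- by move=> c; rewrite scaler0.
- by move=> c q r; rewrite scalerDr.
rewrite scaler_sumr; apply: eq_bigr => E _; rewrite phi0U /= !scalerA.
by congr (_ * _ *: _); apply: mulrC.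
Qed.

(** The values of [act (phi0 K0) c] on the basis, for a function [c] on
    isoclasses not yet known to come from a character. *)
Definition act_on (c : qp -> K) (p : qp) : {poly K} :=
  \sum_(E | admissible (repr_qp p) E)
     c (isoclass (restr_equiv (repr_qp p) E)) *:
       phi0_on (isoclass (contract_equiv (repr_qp p) E)).

Lemma act_on_isoclass c (A : finType) (P : qposet A) :
  act_on c (isoclass P) =
  \sum_(E | admissible P E)
     c (isoclass (restr_equiv P E)) *: phi0_on (isoclass (contract_equiv P E)).
Proof.
have /iso_qpP[f [g fK gK] fP] := iso_repr_qp P.
exact: (sum_admissible_inv fK gK fP (fun p q => c q *: phi0_on p)).
Qed.

Lemma phi0_on_coef1 p : (phi0_on p)`_1 = (cl p == 1%N)%:R.
Proof.
rewrite -(phi0U K0).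
exact: (homogeneous_coef1 (phi0_homogeneous K0) (@phi0_bullet K K0)).
Qed.

(** Only contracting [P] to a single class gives a linear term, and this is the
    contraction by the total equivalence. *)
Lemma act_on_coef1 c (A : finType) (P : qposet A) :
  (0 < #|A|)%N -> connected_qp P -> (act_on c (isoclass P))`_1 = c (isoclass P).
Proof.
move=> /card_gt0P[x0 _] cP; rewrite act_on_isoclass coef_sum.
rewrite (bigD1 (total_eqv A)) ?total_admissible //= big1 ?addr0 => [|E].
  rewrite coefZ phi0_on_coef1 cl_isoclassT.
  have -> : ncl (contract_equiv P (total_eqv A)) setT == 1%N.
    apply/ncl_eq1P; split; first by apply/set0Pn; exists x0.
    by move=> x y _ _; rewrite /sim_qp !le_contract_eqv // mk_eqvE.
  rewrite mulr1; congr c; apply/isoclassP/iso_qpP; exists id; first by exists id.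
  by move=> x y; rewrite mk_qposetE mk_eqvE andbT.
move=> /andP[/admissibleP[_ s] ET]; rewrite coefZ phi0_on_coef1 cl_isoclassT.
case: ncl_eq1P => [[_ h]|_]; last by rewrite mulr0.
case/negP: ET; apply/eqP/eqv_ext => x y; rewrite -s mk_eqvE.
by apply: h; rewrite inE.
Qed.

Lemma act_on_horner0 c p :
  c empty_qp = 1 -> (act_on c p).[0] = (p == empty_qp)%:R.
Proof.
move=> c1; have [->|] := eqVneq p empty_qp.
  have ord0_eq (E E' : equivalence 'I_0) : E = E' by apply: eqv_ext => -[].
  rewrite /empty_qp act_on_isoclass (big_pred1 (total_eqv 'I_0)).
    by rewrite !(qp_of_card0 _ (card_ord 0)) c1 scale1r phi0_on_empty hornerC.
  move=> E; rewrite (ord0_eq E (total_eqv 'I_0)) /= eqxx.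
  by apply/admissibleP; split=> -[].
rewrite -[p]repr_qpK -cl_eq0 cl_isoclassT ncl_eq0 act_on_isoclass => T0.
rewrite horner_sum big1 // => E _; rewrite hornerZ hornerZ hornerXn expr0n.
by rewrite cl_isoclassT ncl_eq0 (negbTE T0) !mulr0.
Qed.

(** The derivative of [phi0_on] at a contraction marks a maximal class [O];
    after the change of index of [sum_max_class], multiplicativity of [c]
    separates the factor [c O = a O]. *)
Lemma act_on_generator (c a : qp -> K) :
  (forall p q, c (union_qp p q) = c p * c q) ->
  (forall (A : finType) (P : qposet A), (0 < #|A|)%N -> connected_qp P ->
     c (isoclass P) = a (isoclass P)) ->
  a empty_qp = 0 ->
  (forall (A : finType) (P : qposet A),
     ~~ connected_qp P -> a (isoclass P) = 0) ->
  has_generator a (act_on c).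
Proof.
move=> cM cC a0 aD A P; rewrite act_on_isoclass.
rewrite -[LHS]/(deriv _) raddf_sum /=.
transitivity (\sum_(E | admissible P E) \sum_(O | max_class P O E)
   c (isoclass (restr_equiv P E)) *: phi0_on (sub_qp (contract_equiv P E) (~: O))).
  apply: eq_bigr => E _; rewrite derivZ (phi0_on_generator K0) scaler_sumr.
  rewrite big_mkcondr; apply: eq_bigr => O _.
  by case: eqP; rewrite ?scale1r ?scale0r ?scaler0.
rewrite (exchange_big_dep xpredT) //= big_mkcond [RHS]big_mkcond /=.
apply: eq_bigr => O _.
rewrite (sum_max_class P O (fun p q => c q *: phi0_on p)).
have [oO|//] := boolP (open_qp P O).
have [->|O0] /= := eqVneq O set0; first by rewrite sub_qp0 a0 scale0r.
have [cO|nO] := boolP (connected_qp (restr_qp P O)); last first.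
  by rewrite /sub_qp aD ?scale0r.
rewrite act_on_isoclass scaler_sumr; apply: eq_bigr => E _.
by rewrite cM scalerA {1}/sub_qp cC // card_subset_type card_gt0.
Qed.

Lemma character_union (chi : character K) p q :
  (chi << union_qp p q >> : K) = chi << p >> * chi << q >>.
Proof.
rewrite -[RHS](rmorphM chi); congr (chi _).
by rewrite malgM_def fgmulUU mulr1.
Qed.

Lemma character_empty (chi : character K) : (chi << empty_qp >> : K) = 1.
Proof. exact: (rmorph1 chi). Qed.

Lemma character_linext (chi mu : character K) :
  (forall p, (chi << p >> : K) = mu << p >>) -> chi =1 mu.
Proof.
by move=> E x; rewrite (linext_id chi) (linext_id mu); apply: eq_linext.
Qed.

Lemma phi0_leading_character : exists chi : character K,
  (forall p, phi0 << p >> = (chi << p >> : K) *: 'X^(cl p)) /\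
  (forall mu : character K,
     (forall p, phi0 << p >> = (mu << p >> : K) *: 'X^(cl p)) -> mu =1 chi).
Proof.
have [chi chiE] := @lrmorphism_of_basis K K^o (lam K)
  (lam_empty K) (@lam_union K K0).
exists chi; split=> [p|mu muE]; first by rewrite phi0U chiE.
apply: character_linext => p; rewrite chiE.
have /(congr1 (fun q : {poly K} => q`_(cl p))) := muE p.
by rewrite phi0U !coefZ coefXn eqxx !mulr1.
Qed.

Section OrderPolynomial.
Variables (b : bool) (F : qp -> {poly K}).
Hypothesis FE : forall (A : finType) (P : qposet A) k, (0 < k)%N ->
  (F (isoclass P)).[k%:R] = #|mono_maps b P k|%:R.

Let a (p : qp) : K := (F p)`_1.

Let a_empty : a empty_qp = 0.
Proof. by rewrite /a (count_empty K0 FE) coefC. Qed.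

Let a_disconnected (A : finType) (P : qposet A) :
  ~~ connected_qp P -> a (isoclass P) = 0.
Proof.
move=> /disconnected_clopen[O [cO O0 C0]].
have F0 (B : {set A}) : B != set0 -> (F (sub_qp P B))`_0 = 0.
  move=> B0; rewrite -horner_coef0 (count_horner0 K0 FE).
  by rewrite -cl_eq0 cl_sub_qp ncl_eq0 (negbTE B0).
rewrite /a (union_clopen cO) (count_union K0 FE) coefM !big_ord_recl big_ord0 /=.
by rewrite !F0 // mulr0 mul0r !addr0.
Qed.

(** By [act_on_coef1], [alpha] has to be [a] on connected quasi-posets; the
    product over the components is its only multiplicative extension. *)
Lemma order_polynomial_act : exists alpha : character K,
  linext F =1 act phi0 alpha /\
  (forall beta : character K, linext F =1 act phi0 beta -> beta =1 alpha).
Proof.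
have [alpha alphaE] := @lrmorphism_of_basis K K^o (comp_prod a)
  (comp_prod_empty a) (comp_prod_union a).
have actE (chi : character K) p :
    act phi0 chi << p >> = act_on (fun q => chi << q >>) p.
  by rewrite act_phi0_linext linextU.
(* Both sides have the generator [a]. *)
have FA : F =1 act_on (comp_prod a).
  apply: (has_generator_inj K0 a_empty).
  - exact: count_generator FE.
  - apply: act_on_generator => //; first exact: comp_prod_union.
    exact: comp_prod_connected.
  - move=> p; rewrite (count_horner0 K0 FE) act_on_horner0 //.
    exact: comp_prod_empty.
exists alpha; split=> [x|beta betaE].
  rewrite act_phi0_linext; apply: eq_linext => p; rewrite FA.
  by apply: eq_bigr => E _; rewrite alphaE.
apply: character_linext; apply: eq_mult.
- exact: character_union.
- exact: character_union.
- by rewrite !character_empty.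
move=> A P A0 cP; rewrite alphaE comp_prod_connected // /a.
have := betaE << isoclass P >>; rewrite linextU actE => ->.
by rewrite act_on_coef1.
Qed.

End OrderPolynomial.
End Action.

Unset Implicit Arguments.

Theorem proposition30 (K : fieldType) (K0 : [pchar K] =i pred0) :
  exists phi0 : {lrmorphism Hqp K -> {poly K}},
    [/\ [/\ hopf_morphism phi0, homogeneous phi0 &
            forall n : nat, (0 < n)%N -> phi0 << bullet n >> = 'X],
        (forall psi : {lrmorphism Hqp K -> {poly K}},
            hopf_morphism psi -> homogeneous psi ->
            (forall n : nat, (0 < n)%N -> psi << bullet n >> = 'X) ->
            psi =1 phi0),
        (exists lambda : character K,
            (forall P : qp, phi0 << P >> = (lambda << P >> : K) *: 'X^(cl P)) /\
            (forall mu : character K,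
                (forall P : qp, phi0 << P >> = (mu << P >> : K) *: 'X^(cl P)) ->
                mu =1 lambda)),
        (exists alpha : character K,
            ehr K0 =1 act phi0 alpha /\
            (forall beta : character K,
                ehr K0 =1 act phi0 beta -> beta =1 alpha)) &
        (exists alphastr : character K,
            ehrstr K0 =1 act phi0 alphastr /\
            (forall beta : character K,
                ehrstr K0 =1 act phi0 beta -> beta =1 alphastr))].
Proof.
exists (phi0 K0); split.
- split; [exact: phi0_hopf | exact: phi0_homogeneous | exact: phi0_bullet].
- exact: phi0_unique.
- exact: phi0_leading_character.
- apply: (@order_polynomial_act K K0 true) => A P k k0.
  by rewrite -(linextU (fun p => sval (L_poly K0 (repr_qp p))))
             (ehr_isoclass K0 P k0) L_mapsE.
- apply: (@order_polynomial_act K K0 false) => A P k k0.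
  by rewrite -(linextU (fun p => sval (Lstr_poly K0 (repr_qp p))))
             (ehrstr_isoclass K0 P k0) Lstr_mapsE.
Qed.
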